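(* Let $\Gamma\subset\mathbb{R}^3$ be a smooth closed surface with unit normal $n$. Let $v,\lambda:\Gamma\to\mathbb{R}^3$ be vector-valued functions and $\kappa,H:\Gamma\to\mathbb{R}$ scalar functions. Then the quadruple $(v,\kappa,\lambda,H)$ is a solution of the system $$-\Delta_\Gamma v=\kappa n,\qquad v\cdot n=-H,\qquad \Delta_\Gamma\lambda=Hn+\Delta_\Gamma\mathrm{id},\qquad \lambda\cdot n=0\qquad\text{on }\Gamma$$ if and only if $\lambda\equiv 0$, $H=-\Delta_\Gamma\mathrm{id}\cdot n$, and $(v,\kappa)$ is a solution of the system $$-\Delta_\Gamma v=\kappa n,\qquad v\cdot n=\Delta_\Gamma\mathrm{id}\cdot n\qquad\text{on }\Gamma .$$
   Context: $\Gamma$ is compact, without boundary, and oriented by the unit normal field $n$. $\Delta_\Gamma$ is the Laplace--Beltrami operator on $\Gamma$, acting componentwise on $\mathbb{R}^3$-valued functions. $\mathrm{id}:\Gamma\to\mathbb{R}^3$ is $\mathrm{id}(x)=x$. The mean curvature of $\Gamma$ is the scalar function $-\Delta_\Gamma\mathrm{id}\cdot n$; the vector field $\Delta_\Gamma\mathrm{id}$ is normal to $\Gamma$. The vector fields $v,\lambda$ are assumed twice continuously differentiable and the scalar functions $\kappa,H$ continuous, so that the equations hold pointwise. *)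

(* Defs.v *)
From Stdlib Require Import Reals List ClassicalEpsilon.
From Coquelicot Require Import Coquelicot.
Open Scope R_scope.

(** Functions on a surface [Gamma] are total functions on [R3] whose values off
    [Gamma] are irrelevant: every notion below depends only on the values on
    [Gamma]. *)

Definition R2 : Type := (R * R)%type.
Definition R3 : Type := (R * R * R)%type.

Definition c1 (x : R3) : R := fst (fst x).
Definition c2 (x : R3) : R := snd (fst x).
Definition c3 (x : R3) : R := snd x.

Definition dot3 (x y : R3) : R := c1 x * c1 y + c2 x * c2 y + c3 x * c3 y.
Definition cross3 (x y : R3) : R3 :=
  (c2 x * c3 y - c3 x * c2 y,
   c3 x * c1 y - c1 x * c3 y,
   c1 x * c2 y - c2 x * c1 y).

(** [f] is of class C^k on the (open) set [U] of the plane: all iterated partial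
    derivatives of order at most [k] exist and are continuous on [U]. *)
Definition Ck_plane (k : nat) (U : R2 -> Prop) (f : R2 -> R) : Prop :=
  forall x y : R, U (x, y) -> ex_diff_n (fun s t => f (s, t)) k x y.

Definition Ck_plane3 (k : nat) (U : R2 -> Prop) (F : R2 -> R3) : Prop :=
  Ck_plane k U (fun u => c1 (F u)) /\
  Ck_plane k U (fun u => c2 (F u)) /\
  Ck_plane k U (fun u => c3 (F u)).

Definition d1 (X : R2 -> R3) (u : R2) : R3 :=
  (Derive (fun s => c1 (X (s, snd u))) (fst u),
   Derive (fun s => c2 (X (s, snd u))) (fst u),
   Derive (fun s => c3 (X (s, snd u))) (fst u)).

Definition d2 (X : R2 -> R3) (u : R2) : R3 :=
  (Derive (fun t => c1 (X (fst u, t))) (snd u),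
   Derive (fun t => c2 (X (fst u, t))) (snd u),
   Derive (fun t => c3 (X (fst u, t))) (snd u)).

Definition image (X : R2 -> R3) (U : R2 -> Prop) (q : R3) : Prop :=
  exists u : R2, U u /\ X u = q.

(** [X : U -> Gamma] is a local parametrization: smooth, with injective
    differential, and a homeomorphism of [U] onto a relatively open subset of
    [Gamma]. *)
Record local_param (Gamma : R3 -> Prop) (U : R2 -> Prop) (X : R2 -> R3) : Prop :=
  { lp_open : open U;
    lp_smooth : forall k : nat, Ck_plane3 k U X;
    lp_regular : forall u : R2, U u -> cross3 (d1 X u) (d2 X u) <> zero;
    lp_image : exists V : R3 -> Prop,
      open V /\ forall q : R3, image X U q <-> Gamma q /\ V q;
    lp_inverse : exists Y : R3 -> R2,
      (forall u : R2, U u -> Y (X u) = u) /\ continuous_on (image X U) Y }.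

Definition compact3 (K : R3 -> Prop) : Prop :=
  forall (I : Type) (V : I -> R3 -> Prop),
    (forall i, open (V i)) ->
    (forall q, K q -> exists i, V i q) ->
    exists l : list I, forall q, K q -> exists i, In i l /\ V i q.

(** Parameter domains are open subsets of the plane, so the surface has no
    boundary. *)
Record smooth_closed_surface (Gamma : R3 -> Prop) : Prop :=
  { scs_compact : compact3 Gamma;
    scs_param : forall p : R3, Gamma p ->
      exists (U : R2 -> Prop) (X : R2 -> R3), local_param Gamma U X /\ image X U p }.

Definition Ck_surface (k : nat) (Gamma : R3 -> Prop) (f : R3 -> R) : Prop :=
  forall (U : R2 -> Prop) (X : R2 -> R3),
    local_param Gamma U X -> Ck_plane k U (fun u => f (X u)).

Definition Ck_surface3 (k : nat) (Gamma : R3 -> Prop) (F : R3 -> R3) : Prop :=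
  Ck_surface k Gamma (fun p => c1 (F p)) /\
  Ck_surface k Gamma (fun p => c2 (F p)) /\
  Ck_surface k Gamma (fun p => c3 (F p)).

(** [g] is a curve in [Gamma], defined near time 0, with [g 0 = p] and velocity
    [w] there. *)
Definition curve_at (Gamma : R3 -> Prop) (p : R3) (g : R -> R3) (w : R3) : Prop :=
  locally 0 (fun t => Gamma (g t)) /\ g 0 = p /\ is_derive g 0 w.

Definition tangent (Gamma : R3 -> Prop) (p w : R3) : Prop :=
  exists g : R -> R3, curve_at Gamma p g w.

Record unit_normal_field (Gamma : R3 -> Prop) (n : R3 -> R3) : Prop :=
  { unf_continuous : continuous_on Gamma n;
    unf_unit : forall p, Gamma p -> dot3 (n p) (n p) = 1;
    unf_normal : forall p w, Gamma p -> tangent Gamma p w -> dot3 (n p) w = 0 }.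

(** [a] is the tangent vector representing the differential of [f] at [p]:
    the derivative of [f] along a curve with velocity [w] is [a . w].  Such a
    vector is unique, and exists when [f] is C^1 on the surface. *)
Definition is_grad (Gamma : R3 -> Prop) (f : R3 -> R) (p a : R3) : Prop :=
  tangent Gamma p a /\
  forall (g : R -> R3) (w : R3),
    curve_at Gamma p g w -> is_derive (fun t => f (g t)) 0 (dot3 a w).

Definition grad (Gamma : R3 -> Prop) (f : R3 -> R) (p : R3) : R3 :=
  epsilon (inhabits (zero : R3)) (is_grad Gamma f p).

(** Surface divergence: the trace of the tangential Jacobian. *)
Definition div (Gamma : R3 -> Prop) (W : R3 -> R3) (p : R3) : R :=
  c1 (grad Gamma (fun q => c1 (W q)) p) +
  c2 (grad Gamma (fun q => c2 (W q)) p) +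
  c3 (grad Gamma (fun q => c3 (W q)) p).

Definition laplace_beltrami (Gamma : R3 -> Prop) (f : R3 -> R) (p : R3) : R :=
  div Gamma (grad Gamma f) p.

Definition laplace_beltrami3 (Gamma : R3 -> Prop) (F : R3 -> R3) (p : R3) : R3 :=
  (laplace_beltrami Gamma (fun q => c1 (F q)) p,
   laplace_beltrami Gamma (fun q => c2 (F q)) p,
   laplace_beltrami Gamma (fun q => c3 (F q)) p).

Definition id3 (x : R3) : R3 := x.

(* Main.v *)
Require Import Defs.
From Stdlib Require Import Reals List ClassicalEpsilon Lra.
From Coquelicot Require Import Coquelicot.
(* Imported again because Stdlib's [c1] and [d1] shadow those of [Defs]. *)
Import Defs.
Open Scope R_scope.

(** The vector field [Delta id] is normal, so the last two equations give
    [lambda . Delta lambda = 0], hence [Delta |lambda|^2 = 2 |grad lambda|^2 >= 0].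
    No integration by parts is needed to conclude that [lambda = 0]; the weak
    maximum principle suffices.  Put [psi x = x . lambda x].  Since [lambda] is
    tangential, [grad psi = lambda + sum_i x_i grad lambda_i], which is nonzero
    where [lambda] is nonzero and [grad lambda] is small.  If [|lambda|^2] has a
    maximum [M > 0], then at a maximum point of
    [|lambda|^2 + eps * exp (alpha * psi)] the inequality [Delta <= 0] yields
    both [|grad lambda|^2 = O(eps)] and [alpha |grad psi|^2 <= - min (Delta psi)],
    which is contradictory for [alpha] large and then [eps] small. *)

(** * Gradient calculus on a surface *)

(** The function [psi] comes from the equality case. If |lambda|^2 were a positive constant, then
    grad lambda = 0 and lambda would be a locally constant tangent vector; the height x . lambda
    would have gradient lambda everywhere, yet on a compact surface it has a maximum, where its
    gradient vanishes. [psi] turns this into an estimate that needs grad lambda small at a single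
    point. The sign of Delta psi is unknown, hence the exponential: its Laplacian sets alpha^2 |grad
    psi|^2 against alpha Delta psi, and Delta psi is bounded by compactness.

    Gradients are tested along curves in the surface and selected by [epsilon]. Sum, product and
    chain rules thus reduce to one variable, but existence does not: it is shown in a chart, where
    the curve has to be lifted to the parameter plane and the lift proved differentiable. At a
    maximum, the second-order test only uses curves with continuous velocity, because the vanishing
    gradient removes the acceleration. *)

Definition lin (x : R) (a : R3) (y : R) (b : R3) : R3 :=
  (x * c1 a + y * c1 b, x * c2 a + y * c2 b, x * c3 a + y * c3 b).

Lemma R3_eq (a b : R3) : c1 a = c1 b -> c2 a = c2 b -> c3 a = c3 b -> a = b.
Proof.
destruct a as [[a1 a2] a3], b as [[b1 b2] b3]; unfold c1, c2, c3; simpl.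
intros -> -> ->; reflexivity.
Qed.

Ltac vec := unfold lin, dot3, cross3, c1, c2, c3 in *; simpl in *.

Lemma dot3_eq0 (a : R3) : dot3 a a = 0 -> a = zero.
Proof.
intros h; apply R3_eq; change zero with ((0, 0, 0) : R3); vec; nra.
Qed.

Lemma is_derive_pair {V W : NormedModule R_AbsRing} (f : R -> V) (g : R -> W)
    (t : R) (a : V) (b : W) :
  is_derive f t a -> is_derive g t b ->
  is_derive (V := prod_NormedModule R_AbsRing V W) (fun s => (f s, g s)) t (a, b).
Proof.
intros ha hb.
refine (filterdiff_comp'_2 (W := prod_NormedModule R_AbsRing V W) f g
  (fun a b => (a, b)) t _ _ (fun a b => (a, b)) ha hb _).
apply filterdiff_linear, is_linear_prod; [apply is_linear_fst | apply is_linear_snd].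
Qed.

Lemma is_derive_R3 (g : R -> R3) (t : R) (w : R3) :
  is_derive g t w <->
  is_derive (fun s => c1 (g s)) t (c1 w) /\
  is_derive (fun s => c2 (g s)) t (c2 w) /\
  is_derive (fun s => c3 (g s)) t (c3 w).
Proof.
split.
- intros h; unfold is_derive in *.
  assert (h' : filterdiff (fun s => fst (g s)) (locally t) (fun y => scal y (fst w))).
  { refine (filterdiff_comp' g (fun q : prod_NormedModule R_AbsRing (prod_NormedModule R_AbsRing R_NormedModule R_NormedModule) R_NormedModule => fst q) t _ (fun q => fst q) h _).
    apply filterdiff_linear, is_linear_fst. }
  split; [|split].
  + refine (filterdiff_comp' (fun s => fst (g s)) (fun q : prod_NormedModule R_AbsRing R_NormedModule R_NormedModule => fst q) t _ (fun q => fst q) h' _).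
    apply filterdiff_linear, is_linear_fst.
  + refine (filterdiff_comp' (fun s => fst (g s)) (fun q : prod_NormedModule R_AbsRing R_NormedModule R_NormedModule => snd q) t _ (fun q => snd q) h' _).
    apply filterdiff_linear, is_linear_snd.
  + refine (filterdiff_comp' g (fun q : prod_NormedModule R_AbsRing (prod_NormedModule R_AbsRing R_NormedModule R_NormedModule) R_NormedModule => snd q) t _ (fun q => snd q) h _).
    apply filterdiff_linear, is_linear_snd.
- intros (h1 & h2 & h3); unfold is_derive in *.
  refine (is_derive_ext (fun s => ((c1 (g s), c2 (g s)), c3 (g s)) : R3) g t w _ _).
  { intros s; unfold c1, c2, c3; destruct (g s) as [[? ?] ?]; reflexivity. }
  replace w with ((c1 w, c2 w, c3 w) : R3)
    by (unfold c1, c2, c3; destruct w as [[? ?] ?]; reflexivity).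
  apply (is_derive_pair (V := prod_NormedModule R_AbsRing R_NormedModule R_NormedModule)
    (W := R_NormedModule)); trivial.
  now apply (is_derive_pair (V := R_NormedModule) (W := R_NormedModule)).
Qed.

Lemma is_derive_Rplus (f h : R -> R) (t a b : R) :
  is_derive f t a -> is_derive h t b -> is_derive (fun s => f s + h s) t (a + b).
Proof. intros; now apply (is_derive_plus f h). Qed.

Lemma is_derive_Rmult (f h : R -> R) (t a b : R) :
  is_derive f t a -> is_derive h t b ->
  is_derive (fun s => f s * h s) t (a * h t + f t * b).
Proof. intros; apply (is_derive_mult f h); auto; intros; apply Rmult_comm. Qed.

Lemma is_derive_dot3 (a : R3) (g : R -> R3) (t : R) (w : R3) :
  is_derive g t w -> is_derive (fun s => dot3 a (g s)) t (dot3 a w).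
Proof.
intros h; apply is_derive_R3 in h; destruct h as (h1 & h2 & h3).
unfold dot3; repeat apply is_derive_Rplus; now apply is_derive_scal.
Qed.

Definition has_grad (Gamma : R3 -> Prop) (f : R3 -> R) (p : R3) : Prop :=
  exists a, is_grad Gamma f p a.

Lemma grad_spec (Gamma : R3 -> Prop) (f : R3 -> R) (p : R3) :
  has_grad Gamma f p -> is_grad Gamma f p (grad Gamma f p).
Proof. apply epsilon_spec. Qed.

(** Both vectors are velocities of curves in the surface. Differentiating f along these two curves
    gives a . a = b . a and a . b = b . b, hence |a - b|^2 = 0. *)
Lemma is_grad_unique (Gamma : R3 -> Prop) (f : R3 -> R) (p a b : R3) :
  is_grad Gamma f p a -> is_grad Gamma f p b -> a = b.
Proof.
intros [[ga hga] ha] [[gb hgb] hb].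
assert (e1 := is_derive_unique _ _ _ (ha _ _ hga)).
rewrite (is_derive_unique _ _ _ (hb _ _ hga)) in e1.
assert (e2 := is_derive_unique _ _ _ (hb _ _ hgb)).
rewrite (is_derive_unique _ _ _ (ha _ _ hgb)) in e2.
assert (e : lin 1 a (-1) b = zero).
{ apply dot3_eq0.
  replace (dot3 _ _) with (dot3 a a - dot3 b a - dot3 a b + dot3 b b) by (vec; ring).
  lra. }
apply R3_eq; [assert (k := f_equal c1 e) | assert (k := f_equal c2 e) | assert (k := f_equal c3 e)];
  change zero with ((0, 0, 0) : R3) in k; vec; lra.
Qed.

Lemma grad_eq (Gamma : R3 -> Prop) (f : R3 -> R) (p a : R3) :
  is_grad Gamma f p a -> grad Gamma f p = a.
Proof.
intros h; apply (is_grad_unique Gamma f p); trivial.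
apply grad_spec; now exists a.
Qed.

(** Curves stay in the surface near time 0, so only values there matter. This allows replacing the
    chosen [grad] by a formula valid on the surface only, underneath a further gradient. *)
Lemma is_grad_ext (Gamma : R3 -> Prop) (f h : R3 -> R) (p a : R3) :
  (forall q, Gamma q -> f q = h q) -> is_grad Gamma f p a -> is_grad Gamma h p a.
Proof.
intros e [ht hd]; split; trivial.
intros g w hg; apply is_derive_ext_loc with (2 := hd g w hg).
destruct hg as [hg _]; revert hg; apply filter_imp; auto.
Qed.

(** The subspace property of tangent vectors is supplied by their description
    as the orthogonal complement of a normal [n]. *)
Definition tangent_plane (Gamma : R3 -> Prop) (n : R3 -> R3) : Prop :=
  forall p w, Gamma p -> tangent Gamma p w <-> dot3 (n p) w = 0.

Lemma is_grad_plus (Gamma : R3 -> Prop) (n : R3 -> R3) (f h : R3 -> R) (p a b : R3) :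
  tangent_plane Gamma n -> Gamma p ->
  is_grad Gamma f p a -> is_grad Gamma h p b ->
  is_grad Gamma (fun q => f q + h q) p (lin 1 a 1 b).
Proof.
intros tp hp [ta da] [tb db]; split.
- apply tp in ta; apply tp in tb; trivial; apply tp; trivial.
  vec; lra.
- intros g w hg; replace (dot3 (lin 1 a 1 b) w) with (dot3 a w + dot3 b w) by (vec; ring).
  apply is_derive_Rplus; auto.
Qed.

Lemma is_grad_mult (Gamma : R3 -> Prop) (n : R3 -> R3) (f h : R3 -> R) (p a b : R3) :
  tangent_plane Gamma n -> Gamma p ->
  is_grad Gamma f p a -> is_grad Gamma h p b ->
  is_grad Gamma (fun q => f q * h q) p (lin (f p) b (h p) a).
Proof.
intros tp hp [ta da] [tb db]; split.
- apply tp in ta; apply tp in tb; trivial; apply tp; trivial.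
  replace (dot3 (n p) _) with (f p * dot3 (n p) b + h p * dot3 (n p) a) by (vec; ring).
  rewrite ta, tb; ring.
- intros g w hg.
  replace (dot3 (lin (f p) b (h p) a) w) with (dot3 a w * h (g 0) + f (g 0) * dot3 b w).
  + apply is_derive_Rmult; auto.
  + destruct hg as (_ & -> & _); vec; ring.
Qed.

Lemma is_grad_comp (Gamma : R3 -> Prop) (n : R3 -> R3) (F : R -> R) (f : R3 -> R)
    (p a : R3) (l : R) :
  tangent_plane Gamma n -> Gamma p ->
  is_grad Gamma f p a -> is_derive F (f p) l ->
  is_grad Gamma (fun q => F (f q)) p (lin l a 0 a).
Proof.
intros tp hp [ta da] hF; split.
- apply tp in ta; trivial; apply tp; trivial.
  replace (dot3 (n p) _) with (l * dot3 (n p) a) by (vec; ring).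
  rewrite ta; ring.
- intros g w hg; replace (dot3 (lin l a 0 a) w) with (dot3 a w * l) by (vec; ring).
  apply (is_derive_comp F (fun t => f (g t))); auto.
  destruct hg as (_ & -> & _); trivial.
Qed.

Lemma is_grad_const (Gamma : R3 -> Prop) (n : R3 -> R3) (k : R) (p : R3) :
  tangent_plane Gamma n -> Gamma p -> is_grad Gamma (fun _ => k) p (0, 0, 0).
Proof.
intros tp hp; split.
- apply tp; trivial; vec; ring.
- intros g w _; replace (dot3 _ w) with 0 by (vec; ring).
  apply (is_derive_const k).
Qed.

(** * Second-order calculus: Laplacians of sums, products and exponentials *)

(** The existence facts behind [laplace_beltrami]: without them [epsilon] returns an arbitrary
    vector. *)
Record twice_diff (Gamma : R3 -> Prop) (f : R3 -> R) : Prop :=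
  { td_grad : forall p, Gamma p -> has_grad Gamma f p;
    td_grad1 : forall p, Gamma p -> has_grad Gamma (fun q => c1 (grad Gamma f q)) p;
    td_grad2 : forall p, Gamma p -> has_grad Gamma (fun q => c2 (grad Gamma f q)) p;
    td_grad3 : forall p, Gamma p -> has_grad Gamma (fun q => c3 (grad Gamma f q)) p }.

Lemma div_eq (Gamma : R3 -> Prop) (W : R3 -> R3) (p a1 a2 a3 : R3) :
  is_grad Gamma (fun q => c1 (W q)) p a1 ->
  is_grad Gamma (fun q => c2 (W q)) p a2 ->
  is_grad Gamma (fun q => c3 (W q)) p a3 ->
  div Gamma W p = c1 a1 + c2 a2 + c3 a3.
Proof.
intros h1 h2 h3; unfold div.
now rewrite (grad_eq _ _ _ _ h1), (grad_eq _ _ _ _ h2), (grad_eq _ _ _ _ h3).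
Qed.

(** The rules below are instances: a formula [W] for the gradient and gradients of its components
    give differentiability and the Laplacian together. By uniqueness [W] equals [grad] on the
    surface, and locality carries this under the second gradient. *)
Lemma twice_diff_lap (Gamma : R3 -> Prop) (f : R3 -> R) (W : R3 -> R3) (A1 A2 A3 : R3 -> R3) :
  (forall p, Gamma p -> is_grad Gamma f p (W p)) ->
  (forall p, Gamma p -> is_grad Gamma (fun q => c1 (W q)) p (A1 p)) ->
  (forall p, Gamma p -> is_grad Gamma (fun q => c2 (W q)) p (A2 p)) ->
  (forall p, Gamma p -> is_grad Gamma (fun q => c3 (W q)) p (A3 p)) ->
  twice_diff Gamma f /\
  forall p, Gamma p -> laplace_beltrami Gamma f p = c1 (A1 p) + c2 (A2 p) + c3 (A3 p).
Proof.
intros hf h1 h2 h3.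
assert (e : forall q, Gamma q -> W q = grad Gamma f q).
{ intros q hq; symmetry; apply grad_eq, hf, hq. }
assert (k1 : forall p, Gamma p -> is_grad Gamma (fun q => c1 (grad Gamma f q)) p (A1 p)).
{ intros p hp; apply is_grad_ext with (2 := h1 p hp); intros q hq; now rewrite e. }
assert (k2 : forall p, Gamma p -> is_grad Gamma (fun q => c2 (grad Gamma f q)) p (A2 p)).
{ intros p hp; apply is_grad_ext with (2 := h2 p hp); intros q hq; now rewrite e. }
assert (k3 : forall p, Gamma p -> is_grad Gamma (fun q => c3 (grad Gamma f q)) p (A3 p)).
{ intros p hp; apply is_grad_ext with (2 := h3 p hp); intros q hq; now rewrite e. }
split.
- split; intros p hp; eexists; eauto.
- intros p hp; apply div_eq; auto.
Qed.

(** Serves for fields such as lambda, known to vanish on the surface but arbitrary elsewhere. *)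
Lemma lap_ext (Gamma : R3 -> Prop) (f h : R3 -> R) (p : R3) :
  twice_diff Gamma f -> (forall q, Gamma q -> f q = h q) -> Gamma p ->
  laplace_beltrami Gamma h p = laplace_beltrami Gamma f p.
Proof.
intros hf e hp.
destruct (twice_diff_lap Gamma h (grad Gamma f)
  (fun p => grad Gamma (fun q => c1 (grad Gamma f q)) p)
  (fun p => grad Gamma (fun q => c2 (grad Gamma f q)) p)
  (fun p => grad Gamma (fun q => c3 (grad Gamma f q)) p)) as [_ l].
- intros q hq; apply is_grad_ext with (1 := e); apply grad_spec, hf, hq.
- intros q hq; apply grad_spec, hf, hq.
- intros q hq; apply grad_spec, hf, hq.
- intros q hq; apply grad_spec, hf, hq.
- rewrite l; trivial.
Qed.

Lemma twice_diff_const (Gamma : R3 -> Prop) (n : R3 -> R3) (k : R) :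
  tangent_plane Gamma n ->
  twice_diff Gamma (fun _ => k) /\
  forall p, Gamma p -> laplace_beltrami Gamma (fun _ => k) p = 0.
Proof.
intros tp.
destruct (twice_diff_lap Gamma (fun _ => k) (fun _ => (0, 0, 0))
  (fun _ => (0, 0, 0)) (fun _ => (0, 0, 0)) (fun _ => (0, 0, 0))) as [h l];
  try (intros p hp; apply (is_grad_const Gamma n); trivial).
split; trivial; intros p hp; rewrite l; trivial; vec; ring.
Qed.

Lemma twice_diff_plus (Gamma : R3 -> Prop) (n : R3 -> R3) (f h : R3 -> R) :
  tangent_plane Gamma n -> twice_diff Gamma f -> twice_diff Gamma h ->
  twice_diff Gamma (fun q => f q + h q) /\
  forall p, Gamma p -> laplace_beltrami Gamma (fun q => f q + h q) p
    = laplace_beltrami Gamma f p + laplace_beltrami Gamma h p.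
Proof.
intros tp hf hh.
destruct (twice_diff_lap Gamma (fun q => f q + h q)
  (fun p => lin 1 (grad Gamma f p) 1 (grad Gamma h p))
  (fun p => lin 1 (grad Gamma (fun q => c1 (grad Gamma f q)) p)
                1 (grad Gamma (fun q => c1 (grad Gamma h q)) p))
  (fun p => lin 1 (grad Gamma (fun q => c2 (grad Gamma f q)) p)
                1 (grad Gamma (fun q => c2 (grad Gamma h q)) p))
  (fun p => lin 1 (grad Gamma (fun q => c3 (grad Gamma f q)) p)
                1 (grad Gamma (fun q => c3 (grad Gamma h q)) p))) as [k l].
1: intros p hp; apply (is_grad_plus Gamma n); trivial; apply grad_spec; [apply hf | apply hh]; trivial.
1-3: intros p hp;
  (eapply is_grad_ext; [|apply (is_grad_plus Gamma n); trivial; apply grad_spec; [apply hf | apply hh]; trivial]);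
  intros q hq; unfold lin, c1, c2, c3; simpl; ring.
split; trivial; intros p hp; rewrite l; trivial.
unfold laplace_beltrami, div, lin, c1, c2, c3; simpl; ring.
Qed.

Lemma twice_diff_mult (Gamma : R3 -> Prop) (n : R3 -> R3) (f h : R3 -> R) :
  tangent_plane Gamma n -> twice_diff Gamma f -> twice_diff Gamma h ->
  twice_diff Gamma (fun q => f q * h q) /\
  forall p, Gamma p -> laplace_beltrami Gamma (fun q => f q * h q) p
    = f p * laplace_beltrami Gamma h p + h p * laplace_beltrami Gamma f p
      + 2 * dot3 (grad Gamma f p) (grad Gamma h p).
Proof.
intros tp hf hh.
destruct (twice_diff_lap Gamma (fun q => f q * h q)
  (fun p => lin (f p) (grad Gamma h p) (h p) (grad Gamma f p))
  (* The three rows of the derivative of f grad h + h grad f. Their trace contains grad f . grad h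
     twice. *)
  (fun p => lin 1 (lin (f p) (grad Gamma (fun q => c1 (grad Gamma h q)) p)
                       (c1 (grad Gamma h p)) (grad Gamma f p))
                1 (lin (h p) (grad Gamma (fun q => c1 (grad Gamma f q)) p)
                       (c1 (grad Gamma f p)) (grad Gamma h p)))
  (fun p => lin 1 (lin (f p) (grad Gamma (fun q => c2 (grad Gamma h q)) p)
                       (c2 (grad Gamma h p)) (grad Gamma f p))
                1 (lin (h p) (grad Gamma (fun q => c2 (grad Gamma f q)) p)
                       (c2 (grad Gamma f p)) (grad Gamma h p)))
  (fun p => lin 1 (lin (f p) (grad Gamma (fun q => c3 (grad Gamma h q)) p)
                       (c3 (grad Gamma h p)) (grad Gamma f p))
                1 (lin (h p) (grad Gamma (fun q => c3 (grad Gamma f q)) p)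
                       (c3 (grad Gamma f p)) (grad Gamma h p)))) as [k l].
1: intros p hp; apply (is_grad_mult Gamma n); trivial; apply grad_spec; [apply hf | apply hh]; trivial.
{ intros p hp; apply (is_grad_plus Gamma n); trivial;
  [apply (is_grad_mult Gamma n f (fun q => c1 (grad Gamma h q)))
  |apply (is_grad_mult Gamma n h (fun q => c1 (grad Gamma f q)))]; trivial; apply grad_spec; (apply hf || apply hh); trivial. }
{ intros p hp; apply (is_grad_plus Gamma n); trivial;
  [apply (is_grad_mult Gamma n f (fun q => c2 (grad Gamma h q)))
  |apply (is_grad_mult Gamma n h (fun q => c2 (grad Gamma f q)))]; trivial; apply grad_spec; (apply hf || apply hh); trivial. }
{ intros p hp; apply (is_grad_plus Gamma n); trivial;
  [apply (is_grad_mult Gamma n f (fun q => c3 (grad Gamma h q)))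
  |apply (is_grad_mult Gamma n h (fun q => c3 (grad Gamma f q)))]; trivial; apply grad_spec; (apply hf || apply hh); trivial. }
split; trivial; intros p hp; rewrite l; trivial.
unfold laplace_beltrami, div, dot3, lin, c1, c2, c3; simpl; ring.
Qed.

(** For f = alpha psi the squared gradient grows like alpha^2 and the Laplacian like alpha, so a
    large alpha lets the former dominate. *)
Lemma twice_diff_exp (Gamma : R3 -> Prop) (n : R3 -> R3) (f : R3 -> R) :
  tangent_plane Gamma n -> twice_diff Gamma f ->
  twice_diff Gamma (fun q => exp (f q)) /\
  forall p, Gamma p -> laplace_beltrami Gamma (fun q => exp (f q)) p
    = exp (f p) * (laplace_beltrami Gamma f p + dot3 (grad Gamma f p) (grad Gamma f p)).
Proof.
intros tp hf.
assert (he : forall p, Gamma p -> is_grad Gamma (fun q => exp (f q)) p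
                 (lin (exp (f p)) (grad Gamma f p) 0 (grad Gamma f p))).
{ intros p hp; apply (is_grad_comp Gamma n); trivial.
  - apply grad_spec, hf, hp.
  - apply is_derive_exp. }
destruct (twice_diff_lap Gamma (fun q => exp (f q))
  (fun p => lin (exp (f p)) (grad Gamma f p) 0 (grad Gamma f p))
  (fun p => lin (exp (f p)) (grad Gamma (fun q => c1 (grad Gamma f q)) p)
                (c1 (grad Gamma f p)) (lin (exp (f p)) (grad Gamma f p) 0 (grad Gamma f p)))
  (fun p => lin (exp (f p)) (grad Gamma (fun q => c2 (grad Gamma f q)) p)
                (c2 (grad Gamma f p)) (lin (exp (f p)) (grad Gamma f p) 0 (grad Gamma f p)))
  (fun p => lin (exp (f p)) (grad Gamma (fun q => c3 (grad Gamma f q)) p)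
                (c3 (grad Gamma f p)) (lin (exp (f p)) (grad Gamma f p) 0 (grad Gamma f p)))) as [k l];
  trivial.
{ intros p hp; apply is_grad_ext with (fun q => exp (f q) * c1 (grad Gamma f q)).
  - intros q hq; unfold lin, c1, c2, c3; simpl; ring.
  - apply (is_grad_mult Gamma n (fun q => exp (f q)) (fun q => c1 (grad Gamma f q))); auto.
    apply grad_spec, hf, hp. }
{ intros p hp; apply is_grad_ext with (fun q => exp (f q) * c2 (grad Gamma f q)).
  - intros q hq; unfold lin, c1, c2, c3; simpl; ring.
  - apply (is_grad_mult Gamma n (fun q => exp (f q)) (fun q => c2 (grad Gamma f q))); auto.
    apply grad_spec, hf, hp. }
{ intros p hp; apply is_grad_ext with (fun q => exp (f q) * c3 (grad Gamma f q)).
  - intros q hq; unfold lin, c1, c2, c3; simpl; ring.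
  - apply (is_grad_mult Gamma n (fun q => exp (f q)) (fun q => c3 (grad Gamma f q))); auto.
    apply grad_spec, hf, hp. }
split; trivial; intros p hp; rewrite l; trivial.
unfold laplace_beltrami, div, dot3, lin, c1, c2, c3; simpl; ring.
Qed.

(** * Functions of two real variables *)

Definition diff_at (phi : R2 -> R) (u : R2) (a b : R) : Prop :=
  differentiable_pt_lim (fun s t => phi (s, t)) (fst u) (snd u) a b.

Definition P1 (phi : R2 -> R) (u : R2) : R := Derive (fun s => phi (s, snd u)) (fst u).
Definition P2 (phi : R2 -> R) (u : R2) : R := Derive (fun t => phi (fst u, t)) (snd u).

Definition C0 (U : R2 -> Prop) (phi : R2 -> R) : Prop :=
  forall u, U u -> continuous phi u.

(** Total differentials with continuous coefficients, given by witnesses: sums, products and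
    inverses are then handled without rewriting iterated [Derive]. *)
Definition C1 (U : R2 -> Prop) (phi : R2 -> R) : Prop :=
  exists phi1 phi2, C0 U phi1 /\ C0 U phi2 /\
    forall u, U u -> diff_at phi u (phi1 u) (phi2 u).

Lemma C0_ext (U : R2 -> Prop) (f g : R2 -> R) :
  (forall u, f u = g u) -> C0 U f -> C0 U g.
Proof. intros e h u hu; apply continuous_ext with f; auto. Qed.

Lemma C0_plus (U : R2 -> Prop) (f g : R2 -> R) :
  C0 U f -> C0 U g -> C0 U (fun u => f u + g u).
Proof. intros hf hg u hu; apply (continuous_plus f g); auto. Qed.

Lemma C0_mult (U : R2 -> Prop) (f g : R2 -> R) :
  C0 U f -> C0 U g -> C0 U (fun u => f u * g u).
Proof. intros hf hg u hu; apply (continuous_mult f g); auto. Qed.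

Lemma C0_const (U : R2 -> Prop) (k : R) : C0 U (fun _ => k).
Proof. intros u hu; apply continuous_const. Qed.

Lemma C0_inv (U : R2 -> Prop) (f : R2 -> R) :
  (forall u, U u -> f u <> 0) -> C0 U f -> C0 U (fun u => / f u).
Proof.
intros nz hf u hu; apply continuous_comp; auto.
apply continuous_Rinv; auto.
Qed.

Lemma continuity_2d_pt_continuous (phi : R2 -> R) (u : R2) :
  continuity_2d_pt (fun s t => phi (s, t)) (fst u) (snd u) <-> continuous phi u.
Proof.
rewrite continuity_2d_pt_filterlim.
destruct u as [x y]; split; intros h;
  (eapply filterlim_ext; [|exact h]); intros [s t]; reflexivity.
Qed.

Lemma diff_at_continuous (phi : R2 -> R) (u : R2) (a b : R) :
  diff_at phi u a b -> continuous phi u.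
Proof.
intros h; apply continuity_2d_pt_continuous.
apply differentiable_continuity_pt; exists a, b; exact h.
Qed.

Lemma C1_C0 (U : R2 -> Prop) (phi : R2 -> R) : C1 U phi -> C0 U phi.
Proof. intros (p1 & p2 & _ & _ & h) u hu; eapply diff_at_continuous; eauto. Qed.

Lemma diff_at_comp2 (F : R -> R -> R) (f g : R2 -> R) (u : R2) (l1 l2 a b c d : R) :
  differentiable_pt_lim F (f u) (g u) l1 l2 ->
  diff_at f u a b -> diff_at g u c d ->
  diff_at (fun v => F (f v) (g v)) u (l1 * a + l2 * c) (l1 * b + l2 * d).
Proof.
destruct u as [x y]; intros hF hf hg.
now apply (differentiable_pt_lim_comp F (fun s t => f (s, t)) (fun s t => g (s, t))).
Qed.

Lemma diff_at_plus (f g : R2 -> R) (u : R2) (a b c d : R) :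
  diff_at f u a b -> diff_at g u c d ->
  diff_at (fun v => f v + g v) u (a + c) (b + d).
Proof.
intros hf hg; replace (a + c) with (1 * a + 1 * c) by ring.
replace (b + d) with (1 * b + 1 * d) by ring.
apply (diff_at_comp2 Rplus); trivial.
intros e; exists e; intros s t _ _.
replace (_ - _) with 0 by ring; rewrite Rabs_R0.
apply Rmult_le_pos; [apply Rlt_le, e | apply Rle_trans with (2 := Rmax_l _ _), Rabs_pos].
Qed.

Lemma diff_at_mult (f g : R2 -> R) (u : R2) (a b c d : R) :
  diff_at f u a b -> diff_at g u c d ->
  diff_at (fun v => f v * g v) u (a * g u + f u * c) (b * g u + f u * d).
Proof.
intros hf hg; rewrite (Rmult_comm a), (Rmult_comm b).
apply (diff_at_comp2 Rmult); trivial.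
(* The linearization error of a product is exactly (s - f u)(t - g u), so the radius e serves the
   tolerance e. *)
intros e; exists e; intros s t hs ht.
replace (_ - _) with ((s - f u) * (t - g u)) by ring.
rewrite Rabs_mult; apply Rmult_le_compat; try apply Rabs_pos.
- now apply Rlt_le.
- apply Rmax_r.
Qed.

Lemma diff_at_inv (f : R2 -> R) (u : R2) (a b : R) :
  f u <> 0 -> diff_at f u a b ->
  diff_at (fun v => / f v) u (- / (f u * f u) * a) (- / (f u * f u) * b).
Proof.
intros nz hf.
(* The inverse enters the two-variable chain rule as a function ignoring its second argument, whence
   the zero terms. *)
replace (- / (f u * f u) * a) with (- / (f u * f u) * a + 0 * a) by ring.
replace (- / (f u * f u) * b) with (- / (f u * f u) * b + 0 * b) by ring.
apply (diff_at_comp2 (fun x _ => / x) f f); trivial.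
apply differentiable_pt_lim_proj1_0, is_derive_Reals.
replace (- / (f u * f u)) with (Ropp 1 / f u ^ 2) by (field; trivial).
apply (is_derive_inv (fun x => x)); trivial; apply (is_derive_id (K := R_AbsRing)).
Qed.

Lemma diff_at_const (k : R) (u : R2) : diff_at (fun _ => k) u 0 0.
Proof.
intros e; exists e; intros s t _ _.
replace (_ - _) with 0 by ring; rewrite Rabs_R0.
apply Rmult_le_pos; [apply Rlt_le, e | apply Rle_trans with (2 := Rmax_l _ _), Rabs_pos].
Qed.

Lemma C1_plus (U : R2 -> Prop) (f g : R2 -> R) :
  C1 U f -> C1 U g -> C1 U (fun u => f u + g u).
Proof.
intros (f1 & f2 & hf1 & hf2 & hf) (g1 & g2 & hg1 & hg2 & hg).
exists (fun u => f1 u + g1 u), (fun u => f2 u + g2 u).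
split; [|split]; try now apply C0_plus.
intros u hu; apply diff_at_plus; auto.
Qed.

Lemma C1_mult (U : R2 -> Prop) (f g : R2 -> R) :
  C1 U f -> C1 U g -> C1 U (fun u => f u * g u).
Proof.
intros hf hg; assert (f0 := C1_C0 _ _ hf); assert (g0 := C1_C0 _ _ hg).
destruct hf as (f1 & f2 & hf1 & hf2 & hf), hg as (g1 & g2 & hg1 & hg2 & hg).
exists (fun u => f1 u * g u + f u * g1 u), (fun u => f2 u * g u + f u * g2 u).
split; [|split].
- apply C0_plus; now apply C0_mult.
- apply C0_plus; now apply C0_mult.
- intros u hu; apply diff_at_mult; auto.
Qed.

Lemma C1_const (U : R2 -> Prop) (k : R) : C1 U (fun _ => k).
Proof.
exists (fun _ => 0), (fun _ => 0); split; [|split]; try apply C0_const.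
intros u hu; apply diff_at_const.
Qed.

Lemma C1_minus (U : R2 -> Prop) (f g : R2 -> R) :
  C1 U f -> C1 U g -> C1 U (fun u => f u - g u).
Proof.
intros hf hg.
assert (h := C1_plus U f _ hf (C1_mult U _ _ (C1_const U (-1)) hg)).
destruct h as (f1 & f2 & hf1 & hf2 & h); exists f1, f2; split; [|split]; trivial.
intros u hu; eapply differentiable_pt_lim_ext; [|exact (h u hu)].
exists (mkposreal 1 Rlt_0_1); intros; ring.
Qed.

Lemma C1_inv (U : R2 -> Prop) (f : R2 -> R) :
  (forall u, U u -> f u <> 0) -> C1 U f -> C1 U (fun u => / f u).
Proof.
intros nz hf; assert (f0 := C1_C0 _ _ hf); destruct hf as (f1 & f2 & hf1 & hf2 & hf).
assert (k : C0 U (fun u => - / (f u * f u))).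
{ apply C0_ext with (fun u => (-1) * / (f u * f u)); [intros; ring|].
  apply C0_mult; [apply C0_const|].
  apply (C0_inv U (fun u => f u * f u)).
  - intros u hu; apply Rmult_integral_contrapositive; auto.
  - now apply C0_mult. }
exists (fun u => - / (f u * f u) * f1 u), (fun u => - / (f u * f u) * f2 u).
split; [|split]; try now apply C0_mult.
intros u hu; apply diff_at_inv; auto.
Qed.

Lemma Ck_plane_C0 (k : nat) (U : R2 -> Prop) (phi : R2 -> R) : Ck_plane k U phi -> C0 U phi.
Proof.
intros h u hu; apply continuity_2d_pt_continuous.
destruct u as [x y]; specialize (h x y hu); destruct k; apply h.
Qed.

Lemma Ck_plane_P1 (k : nat) (U : R2 -> Prop) (phi : R2 -> R) :
  Ck_plane (S k) U phi -> Ck_plane k U (P1 phi).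
Proof. intros h x y hu; apply (h x y hu). Qed.

Lemma Ck_plane_P2 (k : nat) (U : R2 -> Prop) (phi : R2 -> R) :
  Ck_plane (S k) U phi -> Ck_plane k U (P2 phi).
Proof. intros h x y hu; apply (h x y hu). Qed.

(** The classical criterion: the first partial exists near u and is continuous at u, and the second
    exists at u. Openness of U provides the neighbourhood. *)
Lemma Ck_plane_diff (k : nat) (U : R2 -> Prop) (phi : R2 -> R) (u : R2) :
  open U -> Ck_plane (S k) U phi -> U u -> diff_at phi u (P1 phi u) (P2 phi u).
Proof.
intros oU h hu; destruct u as [x y].
apply filterdiff_differentiable_pt_lim.
apply (is_derive_filterdiff (fun s t => phi (s, t)) x y (fun s t => P1 phi (s, t))).
- generalize (oU _ hu); apply filter_imp; intros [s t] hst.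
  apply Derive_correct, (h s t hst).
- apply Derive_correct, (h x y hu).
- generalize (Ck_plane_C0 _ _ _ (Ck_plane_P1 _ _ _ h) _ hu).
  apply continuous_ext; intros [s t]; reflexivity.
Qed.

Lemma Ck_plane_C1 (k : nat) (U : R2 -> Prop) (phi : R2 -> R) :
  open U -> Ck_plane (S k) U phi -> C1 U phi.
Proof.
intros oU h; exists (P1 phi), (P2 phi); split; [|split].
- eapply Ck_plane_C0, Ck_plane_P1, h.
- eapply Ck_plane_C0, Ck_plane_P2, h.
- intros u hu; eapply Ck_plane_diff; eauto.
Qed.

(** Differentiability part of the inverse function theorem, along a curve: no
    local invertibility is needed since [u] is given and continuous. *)
Lemma derivable_of_comp (h1 h2 : R2 -> R) (u : R -> R2) (al be : R) :
  diff_at h1 (u 0) 1 0 -> diff_at h2 (u 0) 0 1 -> continuous u 0 ->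
  is_derive (fun t => h1 (u t)) 0 al -> is_derive (fun t => h2 (u t)) 0 be ->
  is_derive (fun t => fst (u t)) 0 al /\ is_derive (fun t => snd (u t)) 0 be.
Proof.
intros d1 d2 cu k1 k2; rewrite !is_derive_Reals in *.
enough (E : forall eps : R, 0 < eps -> exists delta : posreal, forall h, h <> 0 -> Rabs h < delta ->
  Rabs (fst (u h) - fst (u 0) - al * h) < eps * Rabs h /\
  Rabs (snd (u h) - snd (u 0) - be * h) < eps * Rabs h).
{ split; intros eps he; destruct (E eps he) as [delta hd]; exists delta; intros h hn hh;
  rewrite Rplus_0_l; destruct (hd h hn hh) as [r1 r2];
  assert (0 < Rabs h) by now apply Rabs_pos_lt.
  - replace (_ - al) with ((fst (u h) - fst (u 0) - al * h) / h) by (field; trivial).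
    unfold Rdiv; rewrite Rabs_mult, Rabs_inv.
    apply Rmult_lt_reg_r with (Rabs h); trivial; rewrite Rmult_assoc, Rinv_l; lra.
  - replace (_ - be) with ((snd (u h) - snd (u 0) - be * h) / h) by (field; trivial).
    unfold Rdiv; rewrite Rabs_mult, Rabs_inv.
    apply Rmult_lt_reg_r with (Rabs h); trivial; rewrite Rmult_assoc, Rinv_l; lra. }
intros eps he.
set (C := Rabs al + Rabs be).
assert (hC : 0 <= C) by (unfold C; generalize (Rabs_pos al), (Rabs_pos be); lra).
(* The bound 1 / 2 serves to absorb e m into m, where m is the increment of [u], giving m <= (2 C +
   1)|h|. The other bound keeps the resulting error e (2 C + 2)|h| below eps |h|. *)
set (e := Rmin (1 / 2) (eps / (2 * (2 * C + 3)))).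
assert (he0 : 0 < e).
{ apply Rmin_pos; [lra | apply Rdiv_lt_0_compat; lra]. }
assert (he1 : e <= 1 / 2) by apply Rmin_l.
assert (he2 : e * (2 * C + 3) < eps).
{ apply Rle_lt_trans with (eps / (2 * (2 * C + 3)) * (2 * C + 3)).
  - apply Rmult_le_compat_r; [lra | apply Rmin_r].
  - replace (_ * _) with (eps / 2) by (field; lra); lra. }
destruct (d1 (mkposreal e he0)) as [r1 hr1], (d2 (mkposreal e he0)) as [r2 hr2].
destruct (k1 e he0) as [r3 hr3], (k2 e he0) as [r4 hr4]; simpl in hr1, hr2.
assert (L : locally 0 (fun t => ball (u 0) r1 (u t) /\ ball (u 0) r2 (u t))).
{ apply (cu (fun v => ball (u 0) r1 v /\ ball (u 0) r2 v)), filter_and; apply locally_ball. }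
destruct L as [r5 hr5].
assert (hr : 0 < Rmin r5 (Rmin r3 r4)).
{ repeat apply Rmin_pos; apply cond_pos. }
exists (mkposreal _ hr); simpl; intros h hn hh.
assert (hh5 := Rlt_le_trans _ _ _ hh (Rmin_l _ _)).
assert (hh6 := Rlt_le_trans _ _ _ hh (Rmin_r _ _)).
assert (hh3 := Rlt_le_trans _ _ _ hh6 (Rmin_l _ _)).
assert (hh4 := Rlt_le_trans _ _ _ hh6 (Rmin_r _ _)).
destruct (hr5 h) as [[b1 b1'] [b2 b2']].
{ change (Rabs (h - 0) < r5); now rewrite Rminus_0_r. }
specialize (hr1 (fst (u h)) (snd (u h)) b1 b1').
specialize (hr2 (fst (u h)) (snd (u h)) b2 b2').
rewrite <- !surjective_pairing in hr1, hr2.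
specialize (hr3 h hn hh3); specialize (hr4 h hn hh4); rewrite Rplus_0_l in hr3, hr4.
assert (hp : 0 < Rabs h) by now apply Rabs_pos_lt.
assert (q3 : Rabs (h1 (u h) - h1 (u 0) - al * h) < e * Rabs h).
{ replace (_ - _ * _) with (((h1 (u h) - h1 (u 0)) / h - al) * h) by (field; trivial).
  rewrite Rabs_mult; now apply Rmult_lt_compat_r. }
assert (q4 : Rabs (h2 (u h) - h2 (u 0) - be * h) < e * Rabs h).
{ replace (_ - _ * _) with (((h2 (u h) - h2 (u 0)) / h - be) * h) by (field; trivial).
  rewrite Rabs_mult; now apply Rmult_lt_compat_r. }
clear hr3 hr4 hr5.
set (x := fst (u h) - fst (u 0)) in *; set (y := snd (u h) - snd (u 0)) in *.
set (p := h1 (u h) - h1 (u 0)) in *; set (q := h2 (u h) - h2 (u 0)) in *.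
replace (p - (1 * x + 0 * y)) with (p - x) in hr1 by ring.
replace (q - (0 * x + 1 * y)) with (q - y) in hr2 by ring.
set (m := Rmax (Rabs x) (Rabs y)) in *.
assert (hm0 : 0 <= m) by (apply Rle_trans with (2 := Rmax_l _ _), Rabs_pos).
assert (tx : Rabs (x - al * h) <= Rabs (p - al * h) + Rabs (p - x)).
{ rewrite (Rabs_minus_sym p x); replace (x - al * h) with ((p - al * h) + (x - p)) by ring; apply Rabs_triang. }
assert (ty : Rabs (y - be * h) <= Rabs (q - be * h) + Rabs (q - y)).
{ rewrite (Rabs_minus_sym q y); replace (y - be * h) with ((q - be * h) + (y - q)) by ring; apply Rabs_triang. }
assert (bx : Rabs x <= Rabs (x - al * h) + Rabs al * Rabs h).
{ rewrite <- Rabs_mult; replace x with ((x - al * h) + al * h) at 1 by ring; apply Rabs_triang. }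
assert (by' : Rabs y <= Rabs (y - be * h) + Rabs be * Rabs h).
{ rewrite <- Rabs_mult; replace y with ((y - be * h) + be * h) at 1 by ring; apply Rabs_triang. }
assert (aC : Rabs al * Rabs h <= C * Rabs h).
{ apply Rmult_le_compat_r; [lra | unfold C; generalize (Rabs_pos be); lra]. }
assert (bC : Rabs be * Rabs h <= C * Rabs h).
{ apply Rmult_le_compat_r; [lra | unfold C; generalize (Rabs_pos al); lra]. }
(* The increment is bounded in terms of itself; solving for it upgrades continuity of [u] to a
   Lipschitz bound at 0. *)
assert (hm : m <= C * Rabs h + e * Rabs h + e * m).
{ unfold m at 1; apply Rmax_lub; lra. }
assert (em : e * m <= 1 / 2 * m) by (apply Rmult_le_compat_r; lra).
assert (eh : e * Rabs h <= 1 / 2 * Rabs h) by (apply Rmult_le_compat_r; lra).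
assert (hm2 : m <= (2 * C + 1) * Rabs h) by lra.
assert (fin : e * Rabs h + e * m < eps * Rabs h).
{ apply Rle_lt_trans with (e * (2 * C + 3) * Rabs h).
  - assert (e * m <= e * ((2 * C + 1) * Rabs h)) by (apply Rmult_le_compat_l; lra); nra.
  - apply Rmult_lt_compat_r; trivial. }
split; lra.
Qed.

(** * Local parametrizations *)

(** The determinant of the first fundamental form. *)
Definition sq_area (X : R2 -> R3) (u : R2) : R :=
  dot3 (d1 X u) (d1 X u) * dot3 (d2 X u) (d2 X u)
  - dot3 (d1 X u) (d2 X u) * dot3 (d1 X u) (d2 X u).

(** The basis of the tangent plane dual to [d1 X u, d2 X u]. *)
Definition dual1 (X : R2 -> R3) (u : R2) : R3 :=
  lin (dot3 (d2 X u) (d2 X u) * / sq_area X u) (d1 X u)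
      ((-1) * dot3 (d1 X u) (d2 X u) * / sq_area X u) (d2 X u).
Definition dual2 (X : R2 -> R3) (u : R2) : R3 :=
  lin ((-1) * dot3 (d1 X u) (d2 X u) * / sq_area X u) (d1 X u)
      (dot3 (d1 X u) (d1 X u) * / sq_area X u) (d2 X u).

(** Lagrange's identity; through it, regularity of the parametrization makes the determinant
    nonzero. *)
Lemma sq_area_cross (X : R2 -> R3) (u : R2) :
  sq_area X u = dot3 (cross3 (d1 X u) (d2 X u)) (cross3 (d1 X u) (d2 X u)).
Proof. unfold sq_area; generalize (d1 X u), (d2 X u); intros; vec; ring. Qed.

Lemma sq_area_neq0 (Gamma : R3 -> Prop) (U : R2 -> Prop) (X : R2 -> R3) (u : R2) :
  local_param Gamma U X -> U u -> sq_area X u <> 0.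
Proof.
intros lp hu e; apply (lp_regular _ _ _ lp u hu), dot3_eq0.
now rewrite <- sq_area_cross.
Qed.

Lemma dual_eqs (X : R2 -> R3) (u : R2) : sq_area X u <> 0 ->
  dot3 (dual1 X u) (d1 X u) = 1 /\ dot3 (dual1 X u) (d2 X u) = 0 /\
  dot3 (dual2 X u) (d1 X u) = 0 /\ dot3 (dual2 X u) (d2 X u) = 1.
Proof.
unfold dual1, dual2.
assert (D : forall x a y b c, dot3 (lin x a y b) c = x * dot3 a c + y * dot3 b c)
  by (intros; vec; ring).
assert (S : dot3 (d2 X u) (d1 X u) = dot3 (d1 X u) (d2 X u)) by (vec; ring).
intros nz; rewrite !D, !S; unfold sq_area in *.
repeat split; field; trivial.
Qed.

Lemma lp_diff (Gamma : R3 -> Prop) (U : R2 -> Prop) (X : R2 -> R3) (u : R2) :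
  local_param Gamma U X -> U u ->
  diff_at (fun v => c1 (X v)) u (c1 (d1 X u)) (c1 (d2 X u)) /\
  diff_at (fun v => c2 (X v)) u (c2 (d1 X u)) (c2 (d2 X u)) /\
  diff_at (fun v => c3 (X v)) u (c3 (d1 X u)) (c3 (d2 X u)).
Proof.
intros lp hu; destruct (lp_smooth _ _ _ lp 1) as (h1 & h2 & h3).
assert (oU := lp_open _ _ _ lp).
split; [|split]; eapply (Ck_plane_diff 0); eauto.
Qed.

Lemma lp_mem (Gamma : R3 -> Prop) (U : R2 -> Prop) (X : R2 -> R3) (u : R2) :
  local_param Gamma U X -> U u -> Gamma (X u).
Proof.
intros lp hu; destruct (lp_image _ _ _ lp) as (V & _ & h).
apply h; now exists u.
Qed.

Lemma diff_at_curve (phi : R2 -> R) (u : R -> R2) (t a b x y : R) :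
  diff_at phi (u t) a b ->
  is_derive (fun s => fst (u s)) t x -> is_derive (fun s => snd (u s)) t y ->
  is_derive (fun s => phi (u s)) t (a * x + b * y).
Proof.
intros h hx hy; rewrite is_derive_Reals in *.
assert (k := derivable_pt_lim_comp_2d (fun s t => phi (s, t)) _ _ _ _ _ _ _ h hx hy).
apply is_derive_Reals; apply is_derive_Reals in k.
refine (is_derive_ext _ _ _ _ _ k); intros s; now rewrite <- surjective_pairing.
Qed.

(** Stronger than [tangent]: the velocity exists at all times near 0 and is continuous at 0, as the
    second-derivative test along the curve requires. *)
Definition regular_curve (Gamma : R3 -> Prop) (p w : R3) : Prop :=
  exists g g' : R -> R3, g 0 = p /\ g' 0 = w /\
    locally 0 (fun t => Gamma (g t) /\ is_derive g t (g' t)) /\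
    continuous (fun t => c1 (g' t)) 0 /\
    continuous (fun t => c2 (g' t)) 0 /\
    continuous (fun t => c3 (g' t)) 0.

Lemma regular_curve_tangent (Gamma : R3 -> Prop) (p w : R3) :
  regular_curve Gamma p w -> tangent Gamma p w.
Proof.
intros (g & g' & e & e' & hg & _); exists g; split; [|split]; trivial.
- revert hg; apply filter_imp; tauto.
- rewrite <- e'; now apply locally_singleton in hg.
Qed.

Lemma partials_C1 (Gamma : R3 -> Prop) (U : R2 -> Prop) (X : R2 -> R3) :
  local_param Gamma U X ->
  (C1 U (fun u => c1 (d1 X u)) /\ C1 U (fun u => c2 (d1 X u)) /\ C1 U (fun u => c3 (d1 X u))) /\
  (C1 U (fun u => c1 (d2 X u)) /\ C1 U (fun u => c2 (d2 X u)) /\ C1 U (fun u => c3 (d2 X u))).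
Proof.
intros lp; destruct (lp_smooth _ _ _ lp 2) as (h1 & h2 & h3).
assert (oU := lp_open _ _ _ lp).
split; (split; [|split]); apply (Ck_plane_C1 0); trivial;
  (apply (Ck_plane_P1 1) in h1; apply (Ck_plane_P1 1) in h2; apply (Ck_plane_P1 1) in h3; exact h1 || exact h2 || exact h3)
  || (apply (Ck_plane_P2 1) in h1; apply (Ck_plane_P2 1) in h2; apply (Ck_plane_P2 1) in h3; exact h1 || exact h2 || exact h3).
Qed.

(** The curve is the image under X of the straight line through u with direction (x, y). *)
Lemma chart_curve (Gamma : R3 -> Prop) (U : R2 -> Prop) (X : R2 -> R3) (u : R2) (x y : R) :
  local_param Gamma U X -> U u ->
  regular_curve Gamma (X u) (lin x (d1 X u) y (d2 X u)).
Proof.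
intros lp hu.
set (l := fun t : R => (fst u + t * x, snd u + t * y)).
assert (dl : forall t, is_derive (fun s => fst (l s)) t x /\ is_derive (fun s => snd (l s)) t y).
{ intros t; unfold l; simpl; split; auto_derive; trivial; ring. }
assert (l0 : l 0 = u).
{ unfold l; rewrite !Rmult_0_l, !Rplus_0_r; now rewrite <- surjective_pairing. }
assert (cl : continuous l 0).
{ refine (ex_derive_continuous (V := prod_NormedModule R_AbsRing R_NormedModule R_NormedModule) l 0 _).
  exists (x, y); refine (is_derive_pair (fun t => fst (l t)) (fun t => snd (l t)) 0 x y _ _); apply dl. }
exists (fun t => X (l t)), (fun t => lin x (d1 X (l t)) y (d2 X (l t))).
rewrite l0; split; [|split; [|split]]; trivial.
- assert (hU : locally 0 (fun t => U (l t))).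
  { apply cl; rewrite l0; now apply (lp_open _ _ _ lp). }
  revert hU; apply filter_imp; intros t ht; split.
  + now apply (lp_mem Gamma U).
  + destruct (lp_diff _ _ _ _ lp ht) as (h1 & h2 & h3); destruct (dl t) as [hx hy].
    apply is_derive_R3; split; [|split].
    * replace (c1 (lin _ _ _ _)) with (c1 (d1 X (l t)) * x + c1 (d2 X (l t)) * y) by (vec; ring).
      now apply (diff_at_curve (fun v => c1 (X v))).
    * replace (c2 (lin _ _ _ _)) with (c2 (d1 X (l t)) * x + c2 (d2 X (l t)) * y) by (vec; ring).
      now apply (diff_at_curve (fun v => c2 (X v))).
    * replace (c3 (lin _ _ _ _)) with (c3 (d1 X (l t)) * x + c3 (d2 X (l t)) * y) by (vec; ring).
      now apply (diff_at_curve (fun v => c3 (X v))).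
- destruct (partials_C1 _ _ _ lp) as ((k1 & k2 & k3) & (m1 & m2 & m3)).
  assert (E : forall f g, C1 U f -> C1 U g -> continuous (fun t => x * f (l t) + y * g (l t)) 0).
  { intros f g hf hg.
    apply (continuous_comp l (fun v => x * f v + y * g v)); trivial; rewrite l0.
    (* Once the line is forgotten, the claim for all points of U is an instance of [C0 U]. *)
    revert u hu l l0 dl cl; intros u hu _ _ _ _; revert u hu.
    apply C0_plus; apply C0_mult; try apply C0_const; now apply C1_C0. }
  split; [|split]; [apply (E _ _ k1 m1) | apply (E _ _ k2 m2) | apply (E _ _ k3 m3)].
Qed.

(** The image is relatively open, so near X u the surface has no points outside the chart;
    continuity of Y on the image becomes continuity along the surface. *)
Lemma chart_inverse (Gamma : R3 -> Prop) (U : R2 -> Prop) (X : R2 -> R3) (u : R2) :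
  local_param Gamma U X -> U u ->
  exists Y : R3 -> R2, Y (X u) = u /\
    within Gamma (locally (X u)) (fun q => U (Y q) /\ X (Y q) = q) /\
    filterlim Y (within Gamma (locally (X u))) (locally u).
Proof.
intros lp hu.
destruct (lp_image _ _ _ lp) as (V & oV & hV).
destruct (lp_inverse _ _ _ lp) as (Y & hY & cY).
exists Y; split; [auto|split].
- assert (vu : V (X u)) by (apply hV; now exists u).
  unfold within; generalize (oV _ vu); apply filter_imp; intros q vq hq.
  destruct (proj2 (hV q) (conj hq vq)) as (v & hv & <-); now rewrite hY.
- assert (vu : V (X u)) by (apply hV; now exists u).
  rewrite <- (hY u hu) at 2; intros P hP.
  assert (k := cY (X u) (ex_intro _ u (conj hu eq_refl)) P hP).
  unfold filtermap, within in *.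
  generalize (filter_and _ _ (oV _ vu) k); apply filter_imp.
  intros q [vq h] hq; apply h, hV; auto.
Qed.

Lemma is_derive_continuous_R3 (g : R -> R3) (t : R) (w : R3) :
  is_derive g t w -> continuous g t.
Proof. intros h; apply (ex_derive_continuous g t); now exists w. Qed.

(** A curve in the surface lifts through Y to a continuous curve in the plane. Pairing X with the
    dual vectors gives functions with differentials (1, 0) and (0, 1) at u, so the lift is
    differentiable at 0, and the chain rule for f o X finishes. *)
Lemma chart_grad (Gamma : R3 -> Prop) (U : R2 -> Prop) (X : R2 -> R3) (f : R3 -> R)
    (u : R2) (a b : R) :
  local_param Gamma U X -> U u -> diff_at (fun v => f (X v)) u a b ->
  is_grad Gamma f (X u) (lin a (dual1 X u) b (dual2 X u)).
Proof.
intros lp hu hf; split.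
(* Expanded in [d1], [d2] by the inverse Gram matrix, the vector is the velocity of a chart line. *)
- set (r := / sq_area X u).
  replace (lin a (dual1 X u) b (dual2 X u)) with
    (lin (r * (a * dot3 (d2 X u) (d2 X u) - b * dot3 (d1 X u) (d2 X u))) (d1 X u)
         (r * (b * dot3 (d1 X u) (d1 X u) - a * dot3 (d1 X u) (d2 X u))) (d2 X u)).
  { now apply regular_curve_tangent, (chart_curve _ U). }
  unfold dual1, dual2; fold r.
  generalize (dot3 (d1 X u) (d1 X u)), (dot3 (d1 X u) (d2 X u)), (dot3 (d2 X u) (d2 X u)).
  generalize r, (d1 X u), (d2 X u); clear; intros.
  apply R3_eq; vec; ring.
- intros g w (hg & g0 & dg).
  destruct (chart_inverse _ _ _ _ lp hu) as (Y & hY & hYU & cY).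
  assert (cg : filterlim g (locally 0) (within Gamma (locally (X u)))).
  { intros P hP; rewrite <- g0 in hP; apply is_derive_continuous_R3 in dg.
    assert (k := dg _ hP); unfold filtermap in *.
    generalize (filter_and _ _ hg k); apply filter_imp.
    intros t [h1 h2]; auto. }
  set (l := fun t => Y (g t)).
  assert (l0 : l 0 = u) by (unfold l; now rewrite g0).
  assert (hl : locally 0 (fun t => X (l t) = g t)).
  { assert (k := cg _ hYU); unfold filtermap in k; revert k; apply filter_imp; tauto. }
  assert (cl : continuous l 0).
  { unfold continuous; rewrite l0; apply filterlim_comp with (1 := cg); trivial. }
  assert (dd : forall c : R3, diff_at (fun v => dot3 c (X v)) u (dot3 c (d1 X u)) (dot3 c (d2 X u))).
  { intros c; destruct (lp_diff _ _ _ _ lp hu) as (h1 & h2 & h3).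
    assert (E : forall k phi a b, diff_at phi u a b -> diff_at (fun v => k * phi v) u (k * a) (k * b)).
    { intros k phi a' b' h; replace (k * a') with (0 * phi u + k * a') by ring.
      replace (k * b') with (0 * phi u + k * b') by ring.
      apply (diff_at_mult (fun _ => k)); trivial; apply diff_at_const. }
    unfold dot3; repeat apply (fun f g => diff_at_plus f g u); now apply E. }
  destruct (dual_eqs X u (sq_area_neq0 _ _ _ _ lp hu)) as (e1 & e2 & e3 & e4).
  assert (k1 := dd (dual1 X u)); assert (k2 := dd (dual2 X u)).
  rewrite e1, e2 in k1; rewrite e3, e4 in k2; rewrite <- l0 in k1, k2, hf.
  destruct (derivable_of_comp _ _ l (dot3 (dual1 X u) w) (dot3 (dual2 X u) w) k1 k2 cl) as [r1 r2].
  1, 2: apply is_derive_ext_loc with (2 := is_derive_dot3 _ _ _ _ dg);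
    revert hl; apply filter_imp; intros t ->; now rewrite l0.
  replace (dot3 _ w) with (a * dot3 (dual1 X u) w + b * dot3 (dual2 X u) w) by (vec; ring).
  apply is_derive_ext_loc with (fun t => f (X (l t))).
  + revert hl; apply filter_imp; now intros t ->.
  + now apply (diff_at_curve (fun v => f (X v))).
Qed.

Lemma chart_continuous (Gamma : R3 -> Prop) (U : R2 -> Prop) (X : R2 -> R3) (f : R3 -> R) (u : R2) :
  local_param Gamma U X -> U u -> continuous (fun v => f (X v)) u ->
  filterlim f (within Gamma (locally (X u))) (locally (f (X u))).
Proof.
intros lp hu hf.
destruct (chart_inverse _ _ _ _ lp hu) as (Y & hY & hYU & cY).
apply filterlim_ext_loc with (fun q => f (X (Y q))).
- revert hYU; unfold within; apply filter_imp; intros q h hq; now rewrite (proj2 (h hq)).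
- exact (filterlim_comp _ _ _ Y (fun v => f (X v)) _ _ _ cY hf).
Qed.

(** * The tangent plane as the orthogonal complement of the normal *)

(** The normal is orthogonal to [d1] and [d2]. Expanding n and w in [d1], [d2] and N, their cross
    product, gives n . N <> 0 and then N . w = 0, so w is the velocity of a chart line. *)
Lemma tangent_plane_normal (Gamma : R3 -> Prop) (n : R3 -> R3) (p w : R3) :
  smooth_closed_surface Gamma -> unit_normal_field Gamma n -> Gamma p ->
  dot3 (n p) w = 0 -> regular_curve Gamma p w.
Proof.
intros hG hn hp hw.
destruct (scs_param _ hG p hp) as (U & X & lp & (u & hu & <-)).
assert (t1 : dot3 (n (X u)) (d1 X u) = 0).
{ apply (unf_normal _ _ hn); trivial; apply regular_curve_tangent.
  replace (d1 X u) with (lin 1 (d1 X u) 0 (d2 X u)) by (apply R3_eq; vec; ring).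
  now apply (chart_curve _ U). }
assert (t2 : dot3 (n (X u)) (d2 X u) = 0).
{ apply (unf_normal _ _ hn); trivial; apply regular_curve_tangent.
  replace (d2 X u) with (lin 0 (d1 X u) 1 (d2 X u)) at 1 by (apply R3_eq; vec; ring).
  now apply (chart_curve _ U). }
assert (nn := unf_unit _ _ hn _ hp).
assert (nz := sq_area_neq0 _ _ _ _ lp hu).
set (N := cross3 (d1 X u) (d2 X u)).
(* The expansion is multiplied by [sq_area], the square of |N|, which makes it polynomial in [d1],
   [d2] and v. *)
assert (dec : forall v, lin (sq_area X u) v 0 v = lin 1 (lin (sq_area X u * dot3 (dual1 X u) v) (d1 X u)
  (sq_area X u * dot3 (dual2 X u) v) (d2 X u)) (dot3 N v) N).
{ intros v.
  assert (k1 : sq_area X u * dot3 (dual1 X u) v =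
    dot3 (d2 X u) (d2 X u) * dot3 (d1 X u) v - dot3 (d1 X u) (d2 X u) * dot3 (d2 X u) v).
  { unfold dual1; generalize (d1 X u), (d2 X u); intros; vec; field; trivial. }
  assert (k2 : sq_area X u * dot3 (dual2 X u) v =
    dot3 (d1 X u) (d1 X u) * dot3 (d2 X u) v - dot3 (d1 X u) (d2 X u) * dot3 (d1 X u) v).
  { unfold dual2; generalize (d1 X u), (d2 X u); intros; vec; field; trivial. }
  rewrite k1, k2; unfold N, sq_area; generalize (d1 X u), (d2 X u); intros.
  apply R3_eq; vec; ring. }
assert (D : forall x a y b c, dot3 c (lin x a y b) = x * dot3 c a + y * dot3 c b)
  by (intros; vec; ring).
assert (hN : dot3 N w = 0).
{ assert (q1 := f_equal (dot3 (n (X u))) (dec (n (X u)))).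
  assert (q2 := f_equal (dot3 (n (X u))) (dec w)).
  rewrite !D, t1, t2, nn in q1; rewrite !D, t1, t2, hw in q2.
  assert (hNn : dot3 (n (X u)) N <> 0).
  { intros e; rewrite e in q1; apply nz; lra. }
  apply Rmult_eq_reg_r with (2 := hNn); lra. }
replace w with (lin (dot3 (dual1 X u) w) (d1 X u) (dot3 (dual2 X u) w) (d2 X u)).
{ now apply (chart_curve _ U). }
assert (q := dec w); rewrite hN in q.
apply R3_eq; [apply (f_equal c1) in q | apply (f_equal c2) in q | apply (f_equal c3) in q];
  unfold lin in *; unfold c1, c2, c3 in *; simpl in *;
  apply Rmult_eq_reg_l with (2 := nz); lra.
Qed.

Lemma normal_tangent_plane (Gamma : R3 -> Prop) (n : R3 -> R3) :
  smooth_closed_surface Gamma -> unit_normal_field Gamma n -> tangent_plane Gamma n.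
Proof.
intros hG hn p w hp; split.
- now apply (unf_normal _ _ hn).
- intros h; eapply regular_curve_tangent, tangent_plane_normal; eauto.
Qed.

(** * Regularity of gradients and Laplacians of C^2 functions *)

Lemma dual_C1 (Gamma : R3 -> Prop) (U : R2 -> Prop) (X : R2 -> R3) :
  local_param Gamma U X ->
  (C1 U (fun u => c1 (dual1 X u)) /\ C1 U (fun u => c2 (dual1 X u)) /\ C1 U (fun u => c3 (dual1 X u))) /\
  (C1 U (fun u => c1 (dual2 X u)) /\ C1 U (fun u => c2 (dual2 X u)) /\ C1 U (fun u => c3 (dual2 X u))).
Proof.
intros lp; destruct (partials_C1 _ _ _ lp) as ((k1 & k2 & k3) & (m1 & m2 & m3)).
assert (g11 : C1 U (fun u => dot3 (d1 X u) (d1 X u))).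
{ unfold dot3; repeat apply C1_plus; now apply C1_mult. }
assert (g12 : C1 U (fun u => dot3 (d1 X u) (d2 X u))).
{ unfold dot3; repeat apply C1_plus; now apply C1_mult. }
assert (g22 : C1 U (fun u => dot3 (d2 X u) (d2 X u))).
{ unfold dot3; repeat apply C1_plus; now apply C1_mult. }
assert (ga : C1 U (fun u => / sq_area X u)).
{ apply C1_inv.
  - intros u hu; now apply (sq_area_neq0 Gamma U).
  - apply C1_minus; now apply C1_mult. }
assert (g12' : C1 U (fun u => (-1) * dot3 (d1 X u) (d2 X u) * / sq_area X u)).
{ apply C1_mult; trivial; apply C1_mult; trivial; apply C1_const. }
split; (split; [|split]); apply C1_plus; apply C1_mult; trivial; now apply C1_mult.
Qed.

(** In a chart the gradient combines [dual1] and [dual2] with the partials of f o X as coefficients.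
    Its components are therefore C^1 in the parameters, and the chart formula applies again to each
    of them, with continuous coefficients. *)
Lemma Ck_surface_twice_diff (Gamma : R3 -> Prop) (f : R3 -> R) :
  smooth_closed_surface Gamma -> Ck_surface 2 Gamma f ->
  twice_diff Gamma f /\ continuous_on Gamma f /\
  continuous_on Gamma (fun p => c1 (grad Gamma f p)) /\
  continuous_on Gamma (fun p => c2 (grad Gamma f p)) /\
  continuous_on Gamma (fun p => c3 (grad Gamma f p)) /\
  continuous_on Gamma (laplace_beltrami Gamma f).
Proof.
intros hG hf.
assert (main : forall U X, local_param Gamma U X ->
  C0 U (fun u => f (X u)) /\
  (forall u, U u -> has_grad Gamma f (X u)) /\
  (C1 U (fun u => c1 (grad Gamma f (X u))) /\
   C1 U (fun u => c2 (grad Gamma f (X u))) /\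
   C1 U (fun u => c3 (grad Gamma f (X u))))).
{ intros U X lp; assert (h := hf U X lp); assert (oU := lp_open _ _ _ lp).
  assert (G : forall u, U u -> is_grad Gamma f (X u)
    (lin (P1 (fun v => f (X v)) u) (dual1 X u) (P2 (fun v => f (X v)) u) (dual2 X u))).
  { intros u hu; apply (chart_grad Gamma U); trivial; now apply (Ck_plane_diff 1 U). }
  split; [|split].
  - eapply Ck_plane_C0, h.
  - intros u hu; eexists; apply G, hu.
  - destruct (dual_C1 _ _ _ lp) as ((a1 & a2 & a3) & (b1 & b2 & b3)).
    assert (f1 := Ck_plane_C1 0 U _ oU (Ck_plane_P1 _ _ _ h)).
    assert (f2 := Ck_plane_C1 0 U _ oU (Ck_plane_P2 _ _ _ h)).
    (* The formula for [grad] is available on U only; openness makes that enough for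
       differentials. *)
    assert (E : forall F K : R2 -> R, (forall u, U u -> F u = K u) -> C1 U F -> C1 U K).
    { intros F K e (F1 & F2 & q1 & q2 & q); exists F1, F2; split; [|split]; trivial.
      intros u hu; apply differentiable_pt_lim_ext with (2 := q u hu).
      apply locally_2d_locally; rewrite <- surjective_pairing.
      generalize (oU u hu); apply filter_imp; intros [s t] hst; simpl; now apply e. }
    split; [|split].
    + eapply E; [intros u hu; now rewrite (grad_eq _ _ _ _ (G u hu)) |].
      apply C1_plus; now apply C1_mult.
    + eapply E; [intros u hu; now rewrite (grad_eq _ _ _ _ (G u hu)) |].
      apply C1_plus; now apply C1_mult.
    + eapply E; [intros u hu; now rewrite (grad_eq _ _ _ _ (G u hu)) |].
      apply C1_plus; now apply C1_mult. }
assert (C : forall phi, (forall U X, local_param Gamma U X -> C0 U (fun u => phi (X u))) ->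
          continuous_on Gamma phi).
{ intros phi h p hp; destruct (scs_param _ hG p hp) as (U & X & lp & (u & hu & <-)).
  apply (chart_continuous Gamma U); trivial; now apply (h U X). }
assert (G1 : forall phi, (forall U X, local_param Gamma U X -> C1 U (fun u => phi (X u))) ->
   (forall p, Gamma p -> has_grad Gamma phi p) /\
   (forall U X, local_param Gamma U X ->
      C0 U (fun u => c1 (grad Gamma phi (X u))) /\
      C0 U (fun u => c2 (grad Gamma phi (X u))) /\
      C0 U (fun u => c3 (grad Gamma phi (X u))))).
{ intros phi h; split.
  - intros p hp; destruct (scs_param _ hG p hp) as (U & X & lp & (u & hu & <-)).
    destruct (h U X lp) as (p1 & p2 & _ & _ & hd); eexists.
    apply (chart_grad Gamma U); eauto.
  - intros U X lp; destruct (h U X lp) as (p1 & p2 & q1 & q2 & hd).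
    destruct (dual_C1 _ _ _ lp) as ((a1 & a2 & a3) & (b1 & b2 & b3)).
    assert (E : forall F K : R2 -> R, (forall u, U u -> F u = K u) -> C0 U F -> C0 U K).
    { intros F K e q u hu; apply continuous_ext_loc with (2 := q u hu).
      generalize (lp_open _ _ _ lp u hu); apply filter_imp; auto. }
    assert (G : forall u, U u -> is_grad Gamma phi (X u) (lin (p1 u) (dual1 X u) (p2 u) (dual2 X u))).
    { intros u hu; apply (chart_grad Gamma U); auto. }
    split; [|split].
    + eapply E; [intros u hu; now rewrite (grad_eq _ _ _ _ (G u hu)) |].
      apply C0_plus; apply C0_mult; trivial; now apply C1_C0.
    + eapply E; [intros u hu; now rewrite (grad_eq _ _ _ _ (G u hu)) |].
      apply C0_plus; apply C0_mult; trivial; now apply C1_C0.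
    + eapply E; [intros u hu; now rewrite (grad_eq _ _ _ _ (G u hu)) |].
      apply C0_plus; apply C0_mult; trivial; now apply C1_C0. }
destruct (G1 (fun p => c1 (grad Gamma f p))) as [g1 l1]; [intros; now apply main|].
destruct (G1 (fun p => c2 (grad Gamma f p))) as [g2 l2]; [intros; now apply main|].
destruct (G1 (fun p => c3 (grad Gamma f p))) as [g3 l3]; [intros; now apply main|].
split; [|split; [|split; [|split; [|split]]]].
- split; trivial.
  intros p hp; destruct (scs_param _ hG p hp) as (U & X & lp & (u & hu & <-)).
  now apply (main U X lp).
- apply C; intros U X lp; now apply main.
- apply C; intros U X lp; now apply C1_C0, main.
- apply C; intros U X lp; now apply C1_C0, main.
- apply C; intros U X lp; now apply C1_C0, main.
- apply C; intros U X lp; unfold laplace_beltrami, div.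
  repeat apply C0_plus; [now apply (l1 U X) | now apply (l2 U X) | now apply (l3 U X)].
Qed.

(** * The weak maximum principle *)

Lemma derive_local_max (phi : R -> R) (l : R) :
  locally 0 (fun t => phi t <= phi 0) -> is_derive phi 0 l -> l = 0.
Proof.
intros [r hr] hd; apply is_derive_Reals in hd.
assert (pr : derivable_pt phi 0) by (exists l; exact hd).
rewrite <- (derive_pt_eq_0 phi 0 l pr hd).
assert (r0 := cond_pos r).
apply (deriv_maximum phi (- r) r); try lra.
intros x h1 h2; apply hr; change (Rabs (x - 0) < r).
apply Rabs_def1; lra.
Qed.

(** Otherwise phi' is positive just to the right of 0, and the mean value theorem puts phi (r / 2)
    above phi 0. *)
Lemma second_derive_local_max (phi phi' : R -> R) (l : R) :
  locally 0 (fun t => phi t <= phi 0) ->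
  locally 0 (fun t => is_derive phi t (phi' t)) ->
  phi' 0 = 0 -> is_derive phi' 0 l -> l <= 0.
Proof.
intros hm hd h0 hd2; destruct (Rle_or_lt l 0) as [|hl]; trivial; exfalso.
apply is_derive_Reals in hd2; destruct (hd2 l hl) as [r2 hr2].
destruct hm as [r1 hr1], hd as [r3 hr3].
assert (hr : 0 < Rmin r1 (Rmin r2 r3)) by (repeat apply Rmin_pos; apply cond_pos).
set (r := Rmin r1 (Rmin r2 r3)) in *.
assert (le1 : r <= r1) by apply Rmin_l.
assert (le2 : r <= r2) by (apply Rle_trans with (1 := Rmin_r _ _), Rmin_l).
assert (le3 : r <= r3) by (apply Rle_trans with (1 := Rmin_r _ _), Rmin_r).
destruct (MVT_cor2 phi phi' 0 (r / 2)) as (c & e & hc); [lra | |].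
- intros x hx; apply is_derive_Reals, hr3; change (Rabs (x - 0) < r3).
  apply Rabs_def1; lra.
- assert (k : phi (r / 2) <= phi 0).
  { apply hr1; change (Rabs (r / 2 - 0) < r1); apply Rabs_def1; lra. }
  assert (q : 0 < phi' c / c).
  { assert (q := hr2 c); rewrite Rplus_0_l, h0, Rminus_0_r in q.
    assert (q' : Rabs (phi' c / c - l) < l) by (apply q; [lra | apply Rabs_def1; lra]).
    apply Rabs_def2 in q'; lra. }
  assert (0 < phi' c).
  { replace (phi' c) with (phi' c / c * c) by (field; lra).
    apply Rmult_lt_0_compat; lra. }
  nra.
Qed.

(** The quotient f(t) k(t) / t converges because f(t) / t does and k is continuous. It is meant for
    a vanishing gradient times the velocity of a curve, whose acceleration may not exist. *)
Lemma is_derive_mult_vanishing (f k : R -> R) (l : R) :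
  f 0 = 0 -> is_derive f 0 l -> continuous k 0 ->
  is_derive (fun t => f t * k t) 0 (l * k 0).
Proof.
intros f0 hf hk; apply is_derive_Reals; apply is_derive_Reals in hf.
intros eps he.
(* The tolerance e causes the errors e, e |k 0| and e |l|; the constant 2 instead of 1 makes the
   final inequality strict. *)
set (D := Rabs l + Rabs (k 0) + 2).
assert (hD : 0 < D) by (unfold D; generalize (Rabs_pos l), (Rabs_pos (k 0)); lra).
set (e := Rmin 1 (eps / D)).
assert (e0 : 0 < e) by (apply Rmin_pos; [lra | apply Rdiv_lt_0_compat; lra]).
assert (e1 : e <= 1) by apply Rmin_l.
assert (e2 : e * D <= eps).
{ apply Rle_trans with (eps / D * D).
  - apply Rmult_le_compat_r; [lra | apply Rmin_r].
  - right; field; lra. }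
destruct (hf e e0) as [r1 hr1].
assert (L := hk _ (locally_ball (k 0) (mkposreal e e0))); destruct L as [r2 hr2].
assert (hr : 0 < Rmin r1 r2) by (apply Rmin_pos; apply cond_pos).
exists (mkposreal _ hr); simpl; intros h hn hh.
assert (hh1 := Rlt_le_trans _ _ _ hh (Rmin_l _ _)).
assert (hh2 := Rlt_le_trans _ _ _ hh (Rmin_r _ _)).
specialize (hr1 h hn hh1); rewrite Rplus_0_l, f0, Rminus_0_r in hr1.
assert (q2 : Rabs (k h - k 0) < e).
{ apply (hr2 h); change (Rabs (h - 0) < r2); now rewrite Rminus_0_r. }
rewrite Rplus_0_l, f0, Rmult_0_l, Rminus_0_r.
replace (f h * k h / h - l * k 0) with
  ((f h / h - l) * (k h - k 0) + ((f h / h - l) * k 0 + l * (k h - k 0))) by (field; trivial).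
set (x := f h / h - l) in *; set (y := k h - k 0) in *.
assert (A1 := Rabs_triang (x * y) (x * k 0 + l * y)).
assert (A2 := Rabs_triang (x * k 0) (l * y)).
rewrite (Rabs_mult x y) in A1; rewrite (Rabs_mult x), (Rabs_mult l) in A2.
assert (B1 : Rabs x * Rabs y <= e * 1).
{ apply Rmult_le_compat; try apply Rabs_pos; lra. }
assert (B2 : Rabs x * Rabs (k 0) <= e * Rabs (k 0)).
{ apply Rmult_le_compat_r; [apply Rabs_pos | lra]. }
assert (B3 : Rabs l * Rabs y <= e * Rabs l).
{ rewrite Rmult_comm; apply Rmult_le_compat_r; [apply Rabs_pos | lra]. }
unfold D in e2; lra.
Qed.

(** The gradient is itself the velocity of a curve, along which f has derivative |grad f|^2. *)
Lemma grad_at_max (Gamma : R3 -> Prop) (f : R3 -> R) (p : R3) :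
  has_grad Gamma f p -> (forall q, Gamma q -> f q <= f p) -> grad Gamma f p = zero.
Proof.
intros hf hm; destruct (grad_spec _ _ _ hf) as [[g hg] hd].
apply dot3_eq0, (derive_local_max (fun t => f (g t))); auto.
destruct hg as (hg & -> & _); revert hg; apply filter_imp; auto.
Qed.

(** The left side is the second derivative of f along a curve of velocity w: differentiating grad f
    . g' leaves no acceleration term, since grad f vanishes at p. *)
Lemma hessian_at_max (Gamma : R3 -> Prop) (f : R3 -> R) (p w : R3) :
  twice_diff Gamma f -> Gamma p -> (forall q, Gamma q -> f q <= f p) ->
  regular_curve Gamma p w ->
  c1 w * dot3 (grad Gamma (fun q => c1 (grad Gamma f q)) p) w +
  c2 w * dot3 (grad Gamma (fun q => c2 (grad Gamma f q)) p) w +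
  c3 w * dot3 (grad Gamma (fun q => c3 (grad Gamma f q)) p) w <= 0.
Proof.
intros hf hp hm (g & g' & g0 & g'0 & hg & k1 & k2 & k3).
assert (z := grad_at_max _ _ _ (td_grad _ _ hf p hp) hm).
assert (cg : curve_at Gamma p g w).
{ split; [|split]; trivial.
  - revert hg; apply filter_imp; tauto.
  - rewrite <- g'0; now apply locally_singleton in hg. }
apply second_derive_local_max with (phi := fun t => f (g t))
  (phi' := fun t => c1 (grad Gamma f (g t)) * c1 (g' t) + c2 (grad Gamma f (g t)) * c2 (g' t)
             + c3 (grad Gamma f (g t)) * c3 (g' t)).
- rewrite g0; revert hg; apply filter_imp; intros t [ht _]; auto.
(* [is_grad] speaks of curves at time 0, so the derivative at time t is taken along s |-> g (t + s)
   and translated back. *)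
- apply locally_locally in hg; revert hg; apply filter_imp; intros t ht.
  assert (ht0 := locally_singleton _ _ ht); destruct ht0 as [h1 h2].
  destruct (grad_spec _ _ _ (td_grad _ _ hf _ h1)) as [_ hd].
  assert (tr : is_derive (fun s : R => t + s) 0 1) by (auto_derive; trivial; ring).
  assert (K : is_derive (fun s => f (g (t + s))) 0 (dot3 (grad Gamma f (g t)) (g' t))).
  { apply hd; split; [|split].
    - assert (cc : continuous (fun s : R => t + s) 0).
      { apply (ex_derive_continuous (fun s : R => t + s)); now exists 1. }
      unfold continuous in cc; rewrite Rplus_0_r in cc.
      assert (k := cc _ ht); unfold filtermap in k; revert k.
      apply filter_imp; tauto.
    - now rewrite Rplus_0_r.
    - replace (g' t) with (scal 1 (g' t)) by apply (scal_one (g' t)).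
      apply (is_derive_comp g (fun s : R => t + s)); trivial.
      now rewrite Rplus_0_r. }
  assert (tr' : is_derive (fun s : R => s - t) t 1) by (auto_derive; trivial; ring).
  apply is_derive_ext with (fun s => f (g (t + (s - t)))).
  { intros s; do 2 f_equal; ring. }
  replace (_ + _) with (1 * dot3 (grad Gamma f (g t)) (g' t)) by (unfold dot3; ring).
  apply (is_derive_comp (fun s => f (g (t + s))) (fun s : R => s - t)); trivial.
  now rewrite Rminus_diag.
- rewrite g0, z; change zero with ((0, 0, 0) : R3); vec; ring.
- assert (D : forall F k : R3 -> R, has_grad Gamma F p -> F p = 0 ->
      continuous (fun t => k (g' t)) 0 ->
      is_derive (fun t => F (g t) * k (g' t)) 0 (k w * dot3 (grad Gamma F p) w)).
  { intros F k hF F0 hk; rewrite <- g'0 at 1; rewrite Rmult_comm.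
    apply (is_derive_mult_vanishing (fun t => F (g t)) (fun t => k (g' t))); trivial.
    - now rewrite g0.
    - now apply grad_spec. }
  assert (z1 : c1 (grad Gamma f p) = 0) by now rewrite z.
  assert (z2 : c2 (grad Gamma f p) = 0) by now rewrite z.
  assert (z3 : c3 (grad Gamma f p) = 0) by now rewrite z.
  apply is_derive_Rplus; [apply is_derive_Rplus|].
  + apply (D (fun q => c1 (grad Gamma f q)) c1); trivial; now apply hf.
  + apply (D (fun q => c2 (grad Gamma f q)) c2); trivial; now apply hf.
  + apply (D (fun q => c3 (grad Gamma f q)) c3); trivial; now apply hf.
Qed.

(** The Hessian form is nonpositive at tangent vectors, and the Laplacian is a sum of its values. *)
Lemma laplace_at_max (Gamma : R3 -> Prop) (n : R3 -> R3) (f : R3 -> R) (p : R3) :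
  smooth_closed_surface Gamma -> unit_normal_field Gamma n ->
  twice_diff Gamma f -> Gamma p -> (forall q, Gamma q -> f q <= f p) ->
  laplace_beltrami Gamma f p <= 0.
Proof.
intros hG hn hf hp hm.
assert (tp := normal_tangent_plane _ _ hG hn).
assert (nn := unf_unit _ _ hn p hp).
assert (Q : forall w, dot3 (n p) w = 0 ->
  c1 w * dot3 (grad Gamma (fun q => c1 (grad Gamma f q)) p) w +
  c2 w * dot3 (grad Gamma (fun q => c2 (grad Gamma f q)) p) w +
  c3 w * dot3 (grad Gamma (fun q => c3 (grad Gamma f q)) p) w <= 0).
{ intros w hw; apply hessian_at_max; trivial; now apply (tangent_plane_normal Gamma n). }
assert (t1 := proj1 (tp _ _ hp) (proj1 (grad_spec _ _ _ (td_grad1 _ _ hf p hp)))).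
assert (t2 := proj1 (tp _ _ hp) (proj1 (grad_spec _ _ _ (td_grad2 _ _ hf p hp)))).
assert (t3 := proj1 (tp _ _ hp) (proj1 (grad_spec _ _ _ (td_grad3 _ _ hf p hp)))).
unfold laplace_beltrami, div; revert Q t1 t2 t3 nn.
generalize (grad Gamma (fun q => c1 (grad Gamma f q)) p),
  (grad Gamma (fun q => c2 (grad Gamma f q)) p),
  (grad Gamma (fun q => c3 (grad Gamma f q)) p), (n p); clear.
intros a1 a2 a3 m Q t1 t2 t3 nn.
assert (tan : forall e, dot3 m (lin 1 e (- dot3 m e) m) = 0).
{ intros e; replace (dot3 m (lin _ _ _ _)) with (dot3 m e - dot3 m e * dot3 m m) by (vec; ring).
  rewrite nn; ring. }
(* the projections of the canonical basis form a tight frame of the tangent plane *)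
assert (q1 := Q _ (tan (1, 0, 0))); assert (q2 := Q _ (tan (0, 1, 0))); assert (q3 := Q _ (tan (0, 0, 1))).
refine (Rle_trans _ _ _ (Req_le _ _ _) (Rle_trans _ _ _ (Rplus_le_compat _ _ _ _ (Rplus_le_compat _ _ _ _ q1 q2) q3) _)); [|lra].
(* The square of I - m m^T is I + (|m|^2 - 2) m m^T; the correction pairs m with the tangent vectors
   [a1], [a2], [a3] and vanishes. *)
match goal with |- ?l = ?r =>
  replace r with (l + (dot3 m m - 2) * (c1 m * dot3 m a1 + c2 m * dot3 m a2 + c3 m * dot3 m a3)) by (vec; ring) end.
rewrite t1, t2, t3; ring.
Qed.

(** * Extrema and bounds on a compact surface *)

(** Without a maximum, the regions f < f(i), for i in the surface, cover it; but the point with the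
    largest of finitely many values f(i) lies in none of the selected regions. *)
Lemma compact_max (Gamma : R3 -> Prop) (f : R3 -> R) (p0 : R3) :
  compact3 Gamma -> Gamma p0 -> continuous_on Gamma f ->
  exists p, Gamma p /\ forall q, Gamma q -> f q <= f p.
Proof.
intros K hp0 hf; destruct (classic (exists p, Gamma p /\ forall q, Gamma q -> f q <= f p)) as [|no]; trivial.
exfalso.
(* Continuity is relative to the surface, so each region is the interior of the set where the bound
   holds for points of the surface. *)
destruct (K {q | Gamma q} (fun i x => locally x (fun y => Gamma y -> f y < f (proj1_sig i)))) as [l hl].
- intros i x hx; now apply locally_locally.
- intros p hp.
  assert (exists q, Gamma q /\ f p < f q) as (q & hq & lt).
  { apply NNPP; intros h; apply no; exists p; split; trivial; intros q hq.
    apply Rnot_lt_le; intros lt; apply h; now exists q. }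
  exists (exist _ q hq); simpl.
  apply (hf p hp (fun y => y < f q)).
  now apply (open_lt (f q)).
- assert (E : exists q, Gamma q /\ forall i, In i l -> f (proj1_sig i) <= f q).
  { clear hl; induction l as [|i l (q & hq & IH)].
    - exists p0; split; trivial; intros i [].
    - destruct (Rle_or_lt (f (proj1_sig i)) (f q)) as [le|lt].
      + exists q; split; trivial; intros j [<-|hj]; auto.
      + exists (proj1_sig i); split; [apply proj2_sig|].
        intros j [<-|hj]; [apply Rle_refl | apply Rle_trans with (f q); [auto|lra]]. }
  destruct E as (q & hq & h); destruct (hl q hq) as (i & hi & hx).
  apply locally_singleton in hx; generalize (hx hq), (h i hi); lra.
Qed.

Lemma continuous_on_plus (Gamma : R3 -> Prop) (f g : R3 -> R) :
  continuous_on Gamma f -> continuous_on Gamma g -> continuous_on Gamma (fun q => f q + g q).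
Proof.
intros hf hg p hp; refine (filterlim_comp_2 _ _ _ (hf p hp) (hg p hp) _).
apply (filterlim_plus (f p) (g p)).
Qed.

Lemma continuous_on_mult (Gamma : R3 -> Prop) (f g : R3 -> R) :
  continuous_on Gamma f -> continuous_on Gamma g -> continuous_on Gamma (fun q => f q * g q).
Proof.
intros hf hg p hp; refine (filterlim_comp_2 _ _ _ (hf p hp) (hg p hp) _).
apply (filterlim_mult (f p) (g p)).
Qed.

Lemma continuous_on_const (Gamma : R3 -> Prop) (k : R) : continuous_on Gamma (fun _ => k).
Proof. intros p _; apply filterlim_const. Qed.

Lemma compact_bounded (Gamma : R3 -> Prop) (f : R3 -> R) :
  compact3 Gamma -> continuous_on Gamma f ->
  exists B, 0 < B /\ forall q, Gamma q -> - B <= f q <= B.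
Proof.
intros K hf; destruct (classic (exists p, Gamma p)) as [[p0 hp0]|no].
- destruct (compact_max Gamma (fun q => f q * f q) p0 K hp0) as (p & hp & h).
  { now apply continuous_on_mult. }
  (* A single maximum, that of f^2, bounds both sides, by |t| <= t^2 + 1. *)
  exists (f p * f p + 1); split; [nra|].
  intros q hq; generalize (h q hq); split; nra.
- exists 1; split; [lra|]; intros q hq; exfalso; apply no; now exists q.
Qed.

(** * Vanishing of the tangential field *)

(** Velocities are orthogonal to n, so e may be replaced by its tangential projection. *)
Lemma is_grad_coord (Gamma : R3 -> Prop) (n : R3 -> R3) (x : R3 -> R) (e p : R3) :
  smooth_closed_surface Gamma -> unit_normal_field Gamma n -> Gamma p ->
  (forall q, x q = dot3 e q) ->
  is_grad Gamma x p (lin 1 e (- dot3 (n p) e) (n p)).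
Proof.
intros hG hn hp hx; split.
- apply (normal_tangent_plane _ _ hG hn); trivial.
  replace (dot3 (n p) (lin _ _ _ _)) with (dot3 (n p) e - dot3 (n p) e * dot3 (n p) (n p)) by (vec; ring).
  rewrite (unf_unit _ _ hn p hp); ring.
- intros g w hg.
  assert (hw : dot3 (n p) w = 0) by (apply (unf_normal _ _ hn); trivial; now exists g).
  replace (dot3 (lin _ _ _ _) w) with (dot3 e w - dot3 (n p) e * dot3 (n p) w) by (vec; ring).
  rewrite hw, Rmult_0_r, Rminus_0_r.
  apply is_derive_ext with (fun t => dot3 e (g t)); [intros; now rewrite hx|].
  apply is_derive_dot3, hg.
Qed.

Lemma grad_c1 (Gamma : R3 -> Prop) (n : R3 -> R3) (p : R3) :
  smooth_closed_surface Gamma -> unit_normal_field Gamma n -> Gamma p ->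
  grad Gamma c1 p = lin 1 (1, 0, 0) (- c1 (n p)) (n p).
Proof.
intros hG hn hp; apply grad_eq.
replace (c1 (n p)) with (dot3 (n p) (1, 0, 0)) by (vec; ring).
apply is_grad_coord; trivial; intros q; vec; ring.
Qed.

Lemma grad_c2 (Gamma : R3 -> Prop) (n : R3 -> R3) (p : R3) :
  smooth_closed_surface Gamma -> unit_normal_field Gamma n -> Gamma p ->
  grad Gamma c2 p = lin 1 (0, 1, 0) (- c2 (n p)) (n p).
Proof.
intros hG hn hp; apply grad_eq.
replace (c2 (n p)) with (dot3 (n p) (0, 1, 0)) by (vec; ring).
apply is_grad_coord; trivial; intros q; vec; ring.
Qed.

Lemma grad_c3 (Gamma : R3 -> Prop) (n : R3 -> R3) (p : R3) :
  smooth_closed_surface Gamma -> unit_normal_field Gamma n -> Gamma p ->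
  grad Gamma c3 p = lin 1 (0, 0, 1) (- c3 (n p)) (n p).
Proof.
intros hG hn hp; apply grad_eq.
replace (c3 (n p)) with (dot3 (n p) (0, 0, 1)) by (vec; ring).
apply is_grad_coord; trivial; intros q; vec; ring.
Qed.

Lemma Ck_surface_coord (k : nat) (Gamma : R3 -> Prop) : Ck_surface3 k Gamma id3.
Proof. split; [|split]; intros U X lp; apply (lp_smooth _ _ _ lp k). Qed.

(* [grad f] is a field of tangent vectors, hence fixed by the tangential
   projector, whose rows are the gradients of the coordinates; taking the
   divergence of this identity gives the orthogonality. *)
Lemma grad_dot_laplace_id (Gamma : R3 -> Prop) (n : R3 -> R3) (f : R3 -> R) (p : R3) :
  smooth_closed_surface Gamma -> unit_normal_field Gamma n ->
  twice_diff Gamma f -> Gamma p ->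
  dot3 (grad Gamma f p) (laplace_beltrami3 Gamma id3 p) = 0.
Proof.
intros hG hn hf hp.
assert (tp := normal_tangent_plane _ _ hG hn).
destruct (Ck_surface_coord 2 Gamma) as (hx1 & hx2 & hx3).
assert (tx1 : twice_diff Gamma c1) by exact (proj1 (Ck_surface_twice_diff _ _ hG hx1)).
assert (tx2 : twice_diff Gamma c2) by exact (proj1 (Ck_surface_twice_diff _ _ hG hx2)).
assert (tx3 : twice_diff Gamma c3) by exact (proj1 (Ck_surface_twice_diff _ _ hG hx3)).
assert (R : forall c : R3 -> R,
  (forall q, Gamma q -> has_grad Gamma (fun q => c (grad Gamma f q)) q) ->
  (forall q, Gamma q -> has_grad Gamma (fun q => c (grad Gamma c1 q)) q) ->
  (forall q, Gamma q -> has_grad Gamma (fun q => c (grad Gamma c2 q)) q) ->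
  (forall q, Gamma q -> has_grad Gamma (fun q => c (grad Gamma c3 q)) q) ->
  (forall q, Gamma q -> c (grad Gamma f q) =
     c1 (grad Gamma f q) * c (grad Gamma c1 q) + c2 (grad Gamma f q) * c (grad Gamma c2 q)
     + c3 (grad Gamma f q) * c (grad Gamma c3 q)) ->
  grad Gamma (fun q => c (grad Gamma f q)) p =
  lin 1 (lin 1 (lin (c1 (grad Gamma f p)) (grad Gamma (fun q => c (grad Gamma c1 q)) p)
                    (c (grad Gamma c1 p)) (grad Gamma (fun q => c1 (grad Gamma f q)) p))
             1 (lin (c2 (grad Gamma f p)) (grad Gamma (fun q => c (grad Gamma c2 q)) p)
                    (c (grad Gamma c2 p)) (grad Gamma (fun q => c2 (grad Gamma f q)) p)))
      1 (lin (c3 (grad Gamma f p)) (grad Gamma (fun q => c (grad Gamma c3 q)) p)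
             (c (grad Gamma c3 p)) (grad Gamma (fun q => c3 (grad Gamma f q)) p))).
{ intros c h0 h1 h2 h3 e; apply grad_eq.
  eapply is_grad_ext; [intros q hq; symmetry; exact (e q hq)|].
  apply (is_grad_plus Gamma n (fun q => c1 (grad Gamma f q) * c (grad Gamma c1 q) + c2 (grad Gamma f q) * c (grad Gamma c2 q)) (fun q => c3 (grad Gamma f q) * c (grad Gamma c3 q)) p _ _ tp hp).
  - apply (is_grad_plus Gamma n (fun q => c1 (grad Gamma f q) * c (grad Gamma c1 q)) (fun q => c2 (grad Gamma f q) * c (grad Gamma c2 q)) p _ _ tp hp).
    + apply (is_grad_mult Gamma n (fun q => c1 (grad Gamma f q)) (fun q => c (grad Gamma c1 q)) p _ _ tp hp);
      apply grad_spec; auto; now apply hf.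
    + apply (is_grad_mult Gamma n (fun q => c2 (grad Gamma f q)) (fun q => c (grad Gamma c2 q)) p _ _ tp hp);
      apply grad_spec; auto; now apply hf.
  - apply (is_grad_mult Gamma n (fun q => c3 (grad Gamma f q)) (fun q => c (grad Gamma c3 q)) p _ _ tp hp);
      apply grad_spec; auto; now apply hf. }
assert (tf : forall q, Gamma q -> dot3 (n q) (grad Gamma f q) = 0).
{ intros q hq; apply tp; trivial; apply grad_spec, hf, hq. }
assert (r1 := R c1 (td_grad1 _ _ hf) (td_grad1 _ _ tx1) (td_grad1 _ _ tx2) (td_grad1 _ _ tx3)).
assert (r2 := R c2 (td_grad2 _ _ hf) (td_grad2 _ _ tx1) (td_grad2 _ _ tx2) (td_grad2 _ _ tx3)).
assert (r3 := R c3 (td_grad3 _ _ hf) (td_grad3 _ _ tx1) (td_grad3 _ _ tx2) (td_grad3 _ _ tx3)).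
clear R.
assert (pr : forall c : R3 -> R, c = c1 \/ c = c2 \/ c = c3 ->
   forall q, Gamma q -> c (grad Gamma f q) =
     c1 (grad Gamma f q) * c (grad Gamma c1 q) + c2 (grad Gamma f q) * c (grad Gamma c2 q)
     + c3 (grad Gamma f q) * c (grad Gamma c3 q)).
{ intros c hc q hq; rewrite (grad_c1 _ _ _ hG hn hq), (grad_c2 _ _ _ hG hn hq), (grad_c3 _ _ _ hG hn hq).
  assert (T := tf q hq); revert T; generalize (grad Gamma f q), (n q); clear -hc.
  intros a m T.
  assert (k : c a = c a - c m * dot3 m a) by (rewrite T; ring).
  rewrite k; destruct hc as [-> | [-> | ->]]; vec; ring. }
specialize (r1 (pr c1 (or_introl eq_refl))).
specialize (r2 (pr c2 (or_intror (or_introl eq_refl)))).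
specialize (r3 (pr c3 (or_intror (or_intror eq_refl)))).
clear pr.
assert (t1 : dot3 (n p) (grad Gamma (fun q => c1 (grad Gamma f q)) p) = 0).
{ apply tp; trivial; apply grad_spec, hf, hp. }
assert (t2 : dot3 (n p) (grad Gamma (fun q => c2 (grad Gamma f q)) p) = 0).
{ apply tp; trivial; apply grad_spec, hf, hp. }
assert (t3 : dot3 (n p) (grad Gamma (fun q => c3 (grad Gamma f q)) p) = 0).
{ apply tp; trivial; apply grad_spec, hf, hp. }
apply (f_equal c1) in r1; apply (f_equal c2) in r2; apply (f_equal c3) in r3.
rewrite (grad_c1 _ _ _ hG hn hp), (grad_c2 _ _ _ hG hn hp), (grad_c3 _ _ _ hG hn hp) in r1, r2, r3.
unfold laplace_beltrami3, laplace_beltrami, div, id3.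
change (fun q => c1 q) with c1; change (fun q => c2 q) with c2; change (fun q => c3 q) with c3.
revert r1 r2 r3 t1 t2 t3.
generalize (grad Gamma (fun q => c1 (grad Gamma f q)) p), (grad Gamma (fun q => c2 (grad Gamma f q)) p),
  (grad Gamma (fun q => c3 (grad Gamma f q)) p).
generalize (grad Gamma (fun q => c1 (grad Gamma c1 q)) p), (grad Gamma (fun q => c2 (grad Gamma c1 q)) p),
  (grad Gamma (fun q => c3 (grad Gamma c1 q)) p).
generalize (grad Gamma (fun q => c1 (grad Gamma c2 q)) p), (grad Gamma (fun q => c2 (grad Gamma c2 q)) p),
  (grad Gamma (fun q => c3 (grad Gamma c2 q)) p).
generalize (grad Gamma (fun q => c1 (grad Gamma c3 q)) p), (grad Gamma (fun q => c2 (grad Gamma c3 q)) p),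
  (grad Gamma (fun q => c3 (grad Gamma c3 q)) p).
generalize (grad Gamma f p) (n p); clear.
intros w m x31 x32 x33 x21 x22 x23 x11 x12 x13 g1 g2 g3 r1 r2 r3 t1 t2 t3.
(* In the sum of [r1], [r2], [r3] the second derivatives of f cancel up to these products. *)
assert (s1 : c1 m * dot3 m g1 = 0) by (rewrite t1; ring).
assert (s2 : c2 m * dot3 m g2 = 0) by (rewrite t2; ring).
assert (s3 : c3 m * dot3 m g3 = 0) by (rewrite t3; ring).
vec; lra.
Qed.

(** The preceding orthogonality, for the three coordinates, says that the tangential projection of
    Delta id is zero. *)
Lemma laplace_id_normal (Gamma : R3 -> Prop) (n : R3 -> R3) (p : R3) :
  smooth_closed_surface Gamma -> unit_normal_field Gamma n -> Gamma p ->
  laplace_beltrami3 Gamma id3 p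
  = scal (dot3 (laplace_beltrami3 Gamma id3 p) (n p)) (n p).
Proof.
intros hG hn hp.
destruct (Ck_surface_coord 2 Gamma) as (hx1 & hx2 & hx3).
assert (r1 := grad_dot_laplace_id Gamma n c1 p hG hn (proj1 (Ck_surface_twice_diff _ _ hG hx1)) hp).
assert (r2 := grad_dot_laplace_id Gamma n c2 p hG hn (proj1 (Ck_surface_twice_diff _ _ hG hx2)) hp).
assert (r3 := grad_dot_laplace_id Gamma n c3 p hG hn (proj1 (Ck_surface_twice_diff _ _ hG hx3)) hp).
rewrite (grad_c1 _ _ _ hG hn hp) in r1; rewrite (grad_c2 _ _ _ hG hn hp) in r2;
  rewrite (grad_c3 _ _ _ hG hn hp) in r3.
revert r1 r2 r3; generalize (laplace_beltrami3 Gamma id3 p), (n p); clear; intros l m r1 r2 r3.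
change (scal (dot3 l m) m) with ((dot3 l m * c1 m, dot3 l m * c2 m, dot3 l m * c3 m) : R3).
apply R3_eq; vec; lra.
Qed.

Lemma continuous_on_product_laplace (Gamma : R3 -> Prop) (f h Lf Lh : R3 -> R) (gf gh : R3 -> R3) :
  continuous_on Gamma f -> continuous_on Gamma h ->
  continuous_on Gamma Lf -> continuous_on Gamma Lh ->
  continuous_on Gamma (fun q => c1 (gf q)) -> continuous_on Gamma (fun q => c2 (gf q)) ->
  continuous_on Gamma (fun q => c3 (gf q)) ->
  continuous_on Gamma (fun q => c1 (gh q)) -> continuous_on Gamma (fun q => c2 (gh q)) ->
  continuous_on Gamma (fun q => c3 (gh q)) ->
  continuous_on Gamma (fun q => f q * Lh q + h q * Lf q + 2 * dot3 (gf q) (gh q)).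
Proof.
intros; repeat apply continuous_on_plus; try now apply continuous_on_mult.
apply continuous_on_mult; [apply continuous_on_const|].
unfold dot3; repeat apply continuous_on_plus; now apply continuous_on_mult.
Qed.

Lemma tangential_field_vanishes (Gamma : R3 -> Prop) (n lam : R3 -> R3) :
  smooth_closed_surface Gamma -> unit_normal_field Gamma n ->
  Ck_surface3 2 Gamma lam ->
  (forall p, Gamma p -> dot3 (lam p) (n p) = 0) ->
  (forall p, Gamma p -> dot3 (lam p) (laplace_beltrami3 Gamma lam p) = 0) ->
  forall p, Gamma p -> lam p = zero.
Proof.
intros hG hn (hl1 & hl2 & hl3) ht hD p0 hp0.
assert (tp := normal_tangent_plane _ _ hG hn).
assert (K := scs_compact _ hG).
destruct (Ck_surface_coord 2 Gamma) as (hx1 & hx2 & hx3).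
destruct (Ck_surface_twice_diff _ _ hG hx1) as (tx1 & cx1 & gx11 & gx12 & gx13 & lx1).
destruct (Ck_surface_twice_diff _ _ hG hx2) as (tx2 & cx2 & gx21 & gx22 & gx23 & lx2).
destruct (Ck_surface_twice_diff _ _ hG hx3) as (tx3 & cx3 & gx31 & gx32 & gx33 & lx3).
destruct (Ck_surface_twice_diff _ _ hG hl1) as (tl1 & cl1 & gl11 & gl12 & gl13 & ll1).
destruct (Ck_surface_twice_diff _ _ hG hl2) as (tl2 & cl2 & gl21 & gl22 & gl23 & ll2).
destruct (Ck_surface_twice_diff _ _ hG hl3) as (tl3 & cl3 & gl31 & gl32 & gl33 & ll3).
unfold id3 in *.
set (l1 := fun p => c1 (lam p)) in *; set (l2 := fun p => c2 (lam p)) in *;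
set (l3 := fun p => c3 (lam p)) in *.
change (fun q => c1 q) with c1 in *; change (fun q => c2 q) with c2 in *; change (fun q => c3 q) with c3 in *.
set (S := fun q => l1 q * l1 q + l2 q * l2 q + l3 q * l3 q).
set (psi := fun q => c1 q * l1 q + c2 q * l2 q + c3 q * l3 q).
set (G := grad Gamma) in *; set (L := laplace_beltrami Gamma) in *.
assert (cS : continuous_on Gamma S).
{ repeat apply continuous_on_plus; now apply continuous_on_mult. }
assert (cpsi : continuous_on Gamma psi).
{ repeat apply continuous_on_plus; now apply continuous_on_mult. }
destruct (twice_diff_mult _ _ _ _ tp tl1 tl1) as [s1 e1].
destruct (twice_diff_mult _ _ _ _ tp tl2 tl2) as [s2 e2].
destruct (twice_diff_mult _ _ _ _ tp tl3 tl3) as [s3 e3].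
destruct (twice_diff_plus _ _ _ _ tp s1 s2) as [s12 e12].
destruct (twice_diff_plus _ _ _ _ tp s12 s3) as [tS e123].
set (E := fun q => dot3 (G l1 q) (G l1 q) + dot3 (G l2 q) (G l2 q) + dot3 (G l3 q) (G l3 q)).
(* The terms l_i Delta l_i add up to lambda . Delta lambda = 0, so only the squared gradients
   survive. *)
assert (LS : forall q, Gamma q -> L S q = 2 * E q).
{ intros q hq; unfold S; unfold L; rewrite e123, e12, e1, e2, e3; trivial.
  assert (k := hD q hq); unfold laplace_beltrami3 in k.
  change (l1 q * L l1 q + l2 q * L l2 q + l3 q * L l3 q = 0) in k.
  fold L; unfold E; fold G; lra. }
clear s1 s2 s3 s12 e1 e2 e3 e12 e123.
destruct (twice_diff_mult _ _ _ _ tp tx1 tl1) as [s1 e1].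
destruct (twice_diff_mult _ _ _ _ tp tx2 tl2) as [s2 e2].
destruct (twice_diff_mult _ _ _ _ tp tx3 tl3) as [s3 e3].
destruct (twice_diff_plus _ _ _ _ tp s1 s2) as [s12 e12].
destruct (twice_diff_plus _ _ _ _ tp s12 s3) as [tpsi e123].
assert (cD : continuous_on Gamma (L psi)).
{ apply continuous_on_ext with (fun q =>
    (c1 q * L l1 q + l1 q * L c1 q + 2 * dot3 (G c1 q) (G l1 q)) +
    (c2 q * L l2 q + l2 q * L c2 q + 2 * dot3 (G c2 q) (G l2 q)) +
    (c3 q * L l3 q + l3 q * L c3 q + 2 * dot3 (G c3 q) (G l3 q))).
  - intros q hq; unfold psi, L; rewrite e123, e12, e1, e2, e3; trivial.
  - apply continuous_on_plus; [apply continuous_on_plus|].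
    + exact (continuous_on_product_laplace _ _ _ _ _ _ _ cx1 cl1 lx1 ll1 gx11 gx12 gx13 gl11 gl12 gl13).
    + exact (continuous_on_product_laplace _ _ _ _ _ _ _ cx2 cl2 lx2 ll2 gx21 gx22 gx23 gl21 gl22 gl23).
    + exact (continuous_on_product_laplace _ _ _ _ _ _ _ cx3 cl3 lx3 ll3 gx31 gx32 gx33 gl31 gl32 gl33). }
(* The terms l_i grad x_i add up to the tangential projection of lambda, which is lambda. *)
assert (gpsi : forall q, Gamma q -> G psi q =
  lin 1 (lam q) 1 (lin 1 (lin (c1 q) (G l1 q) (c2 q) (G l2 q)) (c3 q) (G l3 q))).
{ intros q hq.
  assert (m : forall x l, twice_diff Gamma x -> twice_diff Gamma l ->
    is_grad Gamma (fun q => x q * l q) q (lin (x q) (grad Gamma l q) (l q) (grad Gamma x q))).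
  { intros x l hx hl; apply (is_grad_mult Gamma n); trivial; apply grad_spec; [apply hx | apply hl]; trivial. }
  assert (k0 := is_grad_plus _ _ _ _ _ _ _ tp hq
    (is_grad_plus _ _ _ _ _ _ _ tp hq (m _ _ tx1 tl1) (m _ _ tx2 tl2)) (m _ _ tx3 tl3)).
  unfold G; refine (eq_trans (grad_eq _ _ _ _ k0) _); clear m k0.
  rewrite (grad_c1 _ _ _ hG hn hq), (grad_c2 _ _ _ hG hn hq), (grad_c3 _ _ _ hG hn hq).
  assert (k := ht q hq).
  generalize (grad Gamma l1 q), (grad Gamma l2 q), (grad Gamma l3 q); intros g1 g2 g3.
  unfold l1, l2, l3; revert k; generalize (lam q), (n q); clear; intros l m k.
  assert (k1 : c1 m * dot3 l m = 0) by (rewrite k; ring).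
  assert (k2 : c2 m * dot3 l m = 0) by (rewrite k; ring).
  assert (k3 : c3 m * dot3 l m = 0) by (rewrite k; ring).
  apply R3_eq; vec; lra. }
clear s1 s2 s3 s12 e1 e2 e3 e12 e123.
destruct (compact_max Gamma S p0 K hp0 cS) as (pm & hpm & hmax).
destruct (compact_bounded Gamma (L psi) K cD) as (C & hC & bC).
destruct (compact_bounded Gamma (fun q => c1 q * c1 q + c2 q * c2 q + c3 q * c3 q) K) as (B & hB & bB).
{ repeat apply continuous_on_plus; now apply continuous_on_mult. }
destruct (Rle_or_lt (S pm) 0) as [hM|hM].
{ assert (k := hmax p0 hp0); unfold S at 1, l1, l2, l3 in k; apply dot3_eq0; unfold dot3; apply Rle_antisym; nra. }
(* [C] bounds |Delta psi|. The point p below satisfies both alpha |grad psi|^2 <= C and |grad psi|^2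
   > M / 4; this choice, alpha M / 4 = C, makes them contradictory. *)
exfalso; set (M := S pm) in *; set (alpha := 4 * C / M).
assert (ha : 0 < alpha) by (apply Rdiv_lt_0_compat; lra).
set (theta := fun q => exp (alpha * psi q)).
assert (ctheta : continuous_on Gamma theta).
{ intros q hq; unfold theta.
  apply (filterlim_comp _ _ _ (fun q => alpha * psi q) exp _ (locally (alpha * psi q))).
  - apply continuous_on_mult; trivial; apply continuous_on_const.
  - apply (continuous_exp (alpha * psi q)). }
destruct (compact_bounded Gamma theta K ctheta) as (T & hT & bT).
assert (hTaC : 0 < T + B * (T * alpha * C)).
{ repeat (assumption || apply Rplus_lt_0_compat || apply Rmult_lt_0_compat). }
(* Two errors must be small against M: eps T from the perturbation and B eps T alpha C from grad
   lambda. Together they are M / 8. *)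
set (eps := M / (8 * (T + B * (T * alpha * C)))).
assert (heps : 0 < eps) by (apply Rdiv_lt_0_compat; lra).
change (twice_diff Gamma psi) in tpsi; change (twice_diff Gamma S) in tS.
destruct (twice_diff_const Gamma n alpha tp) as [ta ea].
destruct (twice_diff_const Gamma n eps tp) as [te ee].
destruct (twice_diff_mult _ _ _ _ tp ta tpsi) as [tap eap].
destruct (twice_diff_exp _ _ _ tp tap) as [tth eth].
destruct (twice_diff_mult _ _ _ _ tp te tth) as [teth eeth].
destruct (twice_diff_plus _ _ _ _ tp tS teth) as [tPhi ePhi].
destruct (compact_max Gamma (fun q => S q + eps * theta q) p0 K hp0) as (p & hp & hPhi).
{ apply continuous_on_plus; trivial; apply continuous_on_mult; trivial; apply continuous_on_const. }
assert (neg := laplace_at_max _ _ _ p hG hn tPhi hp hPhi).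
assert (gk : forall k, grad Gamma (fun _ => k) p = (0, 0, 0)).
{ intros k; now apply grad_eq, (is_grad_const Gamma n). }
assert (gap : grad Gamma (fun q => alpha * psi q) p = lin alpha (G psi p) (psi p) (0, 0, 0)).
{ apply grad_eq, (is_grad_mult Gamma n (fun _ => alpha) psi p _ _ tp hp).
  - now apply (is_grad_const Gamma n).
  - now apply grad_spec, tpsi. }
rewrite ePhi, eeth, eth, eap, ee, ea, gap, !gk in neg by trivial.
fold L in neg; rewrite LS in neg by trivial.
change (exp (alpha * psi p)) with (theta p) in neg.
set (g := dot3 (G psi p) (G psi p)).
(* The common factor of Delta psi and alpha |grad psi|^2 in the Laplacian of eps theta. *)
set (s := eps * theta p * alpha).
assert (neg' : 2 * E p + s * (L psi p + alpha * g) <= 0).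
{ apply Rle_trans with (2 := neg); right; unfold s, g; generalize (G psi p), (E p), (L psi p), (theta p), (psi p).
  intros; vec; ring. }
assert (th0 : 0 < theta p) by apply exp_pos.
assert (hs : 0 < s) by (unfold s; repeat (assumption || apply Rmult_lt_0_compat)).
assert (hs2 : s * C <= eps * (T * alpha * C)).
{ unfold s; replace (eps * (T * alpha * C)) with (eps * T * alpha * C) by ring.
  repeat apply Rmult_le_compat_r; try lra; apply Rmult_le_compat_l; try lra; now apply bT. }
assert (hE : 0 <= E p) by (unfold E, dot3; nra).
assert (hg : 0 <= g) by (unfold g, dot3; nra).
assert (bL : - C <= L psi p) by now apply bC.
assert (ag : 0 <= alpha * g) by (apply Rmult_le_pos; lra).
(* Dropping the nonnegative alpha g bounds E; dropping E bounds alpha g. *)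
assert (up1 : 2 * E p <= s * C) by nra.
assert (up2 : alpha * g <= C) by nra.
(* Here lambda = grad psi - y, and |y|^2 <= |x|^2 E by Cauchy-Schwarz. *)
assert (low : S p <= 2 * g + 2 * (B * E p)).
{ set (y := lin 1 (lin (c1 p) (G l1 p) (c2 p) (G l2 p)) (c3 p) (G l3 p)).
  assert (cs : dot3 y y <= B * E p).
  { apply Rle_trans with ((c1 p * c1 p + c2 p * c2 p + c3 p * c3 p) * E p).
    - unfold y, E; generalize (G l1 p), (G l2 p), (G l3 p); generalize p; clear; intros x a b d.
      assert (Q : forall x y z r s t : R, (x * r + y * s + z * t) ^ 2 <= (x * x + y * y + z * z) * (r * r + s * s + t * t)).
      { clear; intros x y z r s t.
        assert (0 <= (x * s - y * r) ^ 2 + (x * t - z * r) ^ 2 + (y * t - z * s) ^ 2).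
        { generalize (pow2_ge_0 (x * s - y * r)), (pow2_ge_0 (x * t - z * r)), (pow2_ge_0 (y * t - z * s)); lra. }
        lra. }
      assert (q1 := Q (c1 x) (c2 x) (c3 x) (c1 a) (c1 b) (c1 d)).
      assert (q2 := Q (c1 x) (c2 x) (c3 x) (c2 a) (c2 b) (c2 d)).
      assert (q3 := Q (c1 x) (c2 x) (c3 x) (c3 a) (c3 b) (c3 d)).
      clear Q; vec; lra.
    - apply Rmult_le_compat_r; trivial; now apply bB. }
  assert (cs2 : S p <= 2 * g + 2 * dot3 y y).
  { unfold g; rewrite gpsi by trivial; fold y; unfold S, l1, l2, l3.
    generalize (lam p), y; clear; intros l y.
    assert (0 <= dot3 (lin 1 l 2 y) (lin 1 l 2 y)) by (unfold dot3; nra).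
    vec; lra. }
  lra. }
assert (hS : M <= S p + eps * T).
{ assert (k1 := hPhi pm hpm); fold M in k1.
  assert (0 < eps * theta pm) by (apply Rmult_lt_0_compat; [trivial | apply exp_pos]).
  assert (eps * theta p <= eps * T) by (apply Rmult_le_compat_l; [lra | now apply bT]).
  lra. }
assert (hK : eps * T + B * (eps * (T * alpha * C)) = M / 8).
{ unfold eps; field; lra. }
assert (hBE : 2 * (B * E p) <= B * (eps * (T * alpha * C))).
{ replace (2 * (B * E p)) with (B * (2 * E p)) by ring; apply Rmult_le_compat_l; lra. }
assert (fin : M / 4 < g) by lra.
apply (Rmult_lt_compat_l alpha) in fin; trivial.
replace (alpha * (M / 4)) with C in fin by (unfold alpha; field; lra).
lra.
Qed.

(** * Equivalence of the two systems *)

Theorem mainTheorem1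
  (Gamma : R3 -> Prop) (n : R3 -> R3)
  (hGamma : smooth_closed_surface Gamma)
  (hn : unit_normal_field Gamma n)
  (v lambda : R3 -> R3) (kappa H : R3 -> R)
  (hv : Ck_surface3 2 Gamma v)
  (hlambda : Ck_surface3 2 Gamma lambda)
  (hkappa : continuous_on Gamma kappa)
  (hH : continuous_on Gamma H) :
  (forall p : R3, Gamma p ->
     opp (laplace_beltrami3 Gamma v p) = scal (kappa p) (n p) /\
     dot3 (v p) (n p) = - H p /\
     laplace_beltrami3 Gamma lambda p
       = plus (scal (H p) (n p)) (laplace_beltrami3 Gamma id3 p) /\
     dot3 (lambda p) (n p) = 0)
  <->
  (forall p : R3, Gamma p -> lambda p = zero) /\
  (forall p : R3, Gamma p -> H p = - dot3 (laplace_beltrami3 Gamma id3 p) (n p)) /\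
  (forall p : R3, Gamma p ->
     opp (laplace_beltrami3 Gamma v p) = scal (kappa p) (n p) /\
     dot3 (v p) (n p) = dot3 (laplace_beltrami3 Gamma id3 p) (n p)).
Proof.
assert (tp := normal_tangent_plane _ _ hGamma hn).
assert (Ds : forall a b c k, dot3 a (plus (scal k b) c) = k * dot3 a b + dot3 a c).
{ intros a b c k; change (plus (scal k b) c) with
    ((k * c1 b + c1 c, k * c2 b + c2 c, k * c3 b + c3 c) : R3); vec; ring. }
assert (Dk : forall a b k, dot3 a (scal k b) = k * dot3 a b).
{ intros a b k; change (scal k b) with ((k * c1 b, k * c2 b, k * c3 b) : R3); vec; ring. }
assert (sym : forall a b, dot3 a b = dot3 b a) by (intros; vec; ring).
assert (nn := unf_unit _ _ hn).
assert (L0 : (forall p, Gamma p -> lambda p = zero) ->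
             forall p, Gamma p -> laplace_beltrami3 Gamma lambda p = zero).
{ intros h p hp; destruct (twice_diff_const Gamma n 0 tp) as [t0 e0].
  assert (Z : forall c : R3 -> R, c zero = 0 ->
    laplace_beltrami Gamma (fun q => c (lambda q)) p = 0).
  { intros c hc; rewrite (lap_ext Gamma (fun _ => 0)); auto.
    intros q hq; now rewrite h. }
  unfold laplace_beltrami3; rewrite !Z; reflexivity. }
split.
- intros h.
  assert (lz : forall p, Gamma p -> lambda p = zero).
  { apply (tangential_field_vanishes Gamma n); trivial.
    - intros p hp; apply (h p hp).
    - intros p hp; destruct (h p hp) as (_ & _ & -> & e).
      rewrite (laplace_id_normal Gamma n), Ds, Dk, e by trivial; ring. }
  assert (hHp : forall p, Gamma p -> H p = - dot3 (laplace_beltrami3 Gamma id3 p) (n p)).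
  { intros p hp; destruct (h p hp) as (_ & _ & e & _).
    rewrite L0 in e by trivial.
    (* With lambda = 0 the third equation reads 0 = H n + Delta id; its normal component determines
       H. *)
    apply (f_equal (dot3 (n p))) in e; rewrite Ds, nn in e by trivial.
    replace (dot3 (n p) zero) with 0 in e
      by (change zero with ((0, 0, 0) : R3); vec; ring).
    rewrite sym; lra. }
  split; [|split]; trivial.
  intros p hp; destruct (h p hp) as (e1 & e2 & _); split; trivial.
  rewrite e2, hHp by trivial; ring.
- intros (lz & hHp & h) p hp; destruct (h p hp) as [e1 e2].
  split; [|split; [|split]]; trivial.
  + rewrite e2, hHp by trivial; ring.
  + rewrite L0, hHp by trivial.
    (* As Delta id is normal, it equals - H n, and both sides of the third equation are zero. *)
    assert (e := laplace_id_normal Gamma n p hGamma hn hp).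
    rewrite e at 2; generalize (dot3 (laplace_beltrami3 Gamma id3 p) (n p)); generalize (n p); clear.
    intros m k; apply R3_eq;
      [change (0 = - k * c1 m + k * c1 m)
      |change (0 = - k * c2 m + k * c2 m)
      |change (0 = - k * c3 m + k * c3 m)]; ring.
  + rewrite lz by trivial; change zero with ((0, 0, 0) : R3); vec; ring.
Qed.
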